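(* Let $K:\mathbb N_0\times\mathbb N_0\to[0,\infty)$ be symmetric and bounded with $K(0,\ell)=0$ for every $\ell\in\mathbb N_0$, and let $(\pi^n_t;t\ge 0)$ be the empirical mass density process of the Marcus--Lushnikov chain on $n$ sites with kernel $K$ started from the monodisperse configuration (see context). For every $T>0$, $$\lim_{n\to\infty}\pi^n_\cdot=u$$ in probability with respect to $\mathbb P_n$ and with respect to the $J_1$-Skorohod topology of $\mathcal D([0,T];\mathcal M_+)$, where $u\in\mathcal C([0,T];\mathcal M_+)$ is the unique weak solution of the Smoluchowski equation with kernel $K$ and initial condition $u(0)=\delta_1$ (i.e. $u_\ell(0)=1$ if $\ell=1$ and $u_\ell(0)=0$ otherwise).
   Context: Notation: $\mathbb N=\{1,2,\dots\}$, $\mathbb N_0=\{0,1,2,\dots\}$. For $n\in\mathbb N$ let $\Lambda_n=\{1,\dots,n\}$ and $\Omega_n=\mathbb N_0^{\Lambda_n}$. For $x\in\Lambda_n$, $\delta_x\in\Omega_n$ is the configuration with $(\delta_x)_x=1$ and $(\delta_x)_y=0$ for $y\ne x$. The chain: $(\eta(t);t\ge0)$ is the continuous-time Markov chain on $\Omega_n$ with generator $$L_nf(\eta)=\frac1n\sum_{x\in\Lambda_n}\sum_{y\ne x}K(\eta_x,\eta_y)\big(f(\eta+\eta_x(\delta_y-\delta_x))-f(\eta)\big),$$ started from the monodisperse configuration $\eta_x(0)=1$ for all $x\in\Lambda_n$. (The pair $(x,y)$ ranges over ordered pairs; at rate $\frac1nK(\eta_x,\eta_y)$ the mass at $x$ is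 moved to $y$ and added to the mass at $y$.) For $\ell\in\mathbb N$, $$\pi^n_t(\ell)=\frac1n\#\{x\in\Lambda_n:\eta_x(t)=\ell\}.$$ $\mathcal M_+=\{\pi:\mathbb N\to[0,\infty);\ \sum_{\ell\ge1}\pi(\ell)\le1\}$, with the metric of the norm $\|u\|_1=\sum_{\ell\ge1}|u_\ell|$ of $\ell^1(\mathbb N)$. $\mathcal D([0,T];\mathcal M_+)$ is the space of càdlàg paths; $\mathbb P_n$ is the law of $(\pi^n_t;t\ge0)$. Smoluchowski equation: for $u\in\ell^1(\mathbb N)$ define $\mathcal K u\in\ell^1(\mathbb N)$ by $$(\mathcal K u)_\ell=\sum_{i=1}^{\ell-1}K(i,\ell-i)u_iu_{\ell-i}-2\sum_{i=1}^\infty K(\ell,i)u_\ell u_i .$$ A trajectory $u\in\mathcal C([0,T];\mathcal M_+)$ is a weak solution of the Smoluchowski equation with initial condition $u(0)$ if $u(t)=u(0)+\int_0^t\mathcal K u(s)\,ds$ for every $t\in[0,T]$. *)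

(* Defs.v *)
From HB Require Import structures.
From mathcomp Require Import all_boot all_order all_algebra.
From mathcomp Require Import all_classical all_reals all_analysis.

Set Implicit Arguments.
Unset Strict Implicit.
Unset Printing Implicit Defensive.

Import Order.TTheory GRing.Theory Num.Theory.
Import numFieldNormedType.Exports.

Local Open Scope classical_set_scope.
Local Open Scope ring_scope.

(** A family indexed by {1, 2, ...} is encoded as a function on [nat]; sums start
   at index 1, and the elements of [M_+] are normalised to vanish at index 0, so
   that equality in [Mplus] is equality on {1, 2, ...}. *)

Definition l1norm (R : realType) (u : nat -> R) : \bar R :=
  (\sum_(1 <= l <oo) `|u l|%:E)%E.

Record Mplus (R : realType) := MkMplus {
  density :> nat -> R ;
  density0 : density 0%N = 0 ;
  density_ge0 : forall l, 0 <= density l ;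
  density_le1 : (\sum_(1 <= l <oo) (density l)%:E <= 1)%E }.

HB.instance Definition _ (R : realType) := gen_eqMixin (Mplus R).
HB.instance Definition _ (R : realType) := gen_choiceMixin (Mplus R).

Section Mplus_metric.
Variable R : realType.
Implicit Types u v w : Mplus R.

Lemma Mplus_eqP u v : (forall l, u l = v l) -> u = v.
Proof.
case: u v => [u u0 u1 u2] [v v0 v1 v2] /= /funext uv.
by case: _ / uv v0 v1 v2 => *; congr MkMplus; exact: Prop_irrelevance.
Qed.

Definition l1dist u v : R := fine (l1norm (fun l => u l - v l)).

Lemma l1norm_sub_fin u v : l1norm (fun l => u l - v l) \is a fin_num.
Proof.
rewrite ge0_fin_numE; last by apply: nneseries_ge0 => l _ _; rewrite lee_fin.
apply: (@le_lt_trans _ _ (\sum_(1 <= l <oo) ((u l)%:E + (v l)%:E))%E).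
  apply: lee_nneseries => [l _ _|l _]; rewrite ?lee_fin//.
  by rewrite (le_trans (ler_normB _ _))// !ger0_norm// density_ge0.
rewrite nneseriesD; try by move=> l _ _; rewrite lee_fin density_ge0.
by apply: lte_add_pinfty; apply: (le_lt_trans (density_le1 _)); rewrite ltry.
Qed.

Lemma l1dist_refl u : l1dist u u = 0.
Proof. by rewrite /l1dist /l1norm eseries0// => l _ _; rewrite subrr normr0. Qed.

Lemma l1dist_eq0 u v : l1dist u v = 0 -> u = v.
Proof.
move=> uv0.
have uv : l1norm (fun l => u l - v l) = 0%E.
  by rewrite -(fineK (l1norm_sub_fin u v)) -/(l1dist u v) uv0.
apply: Mplus_eqP => -[|l]; first by rewrite !density0.
apply/eqP; rewrite -subr_eq0 -normr_le0 -lee_fin.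
suff : (`|u l.+1 - v l.+1|%:E <= l1norm (fun l => u l - v l)%R)%E by rewrite uv.
have h : forall n : nat, (1 <= n)%N -> xpredT n -> (0 <= `|u n - v n|%:E)%E.
  by move=> n _ _; rewrite lee_fin.
apply: le_trans (nneseries_lim_ge l.+2 h).
by rewrite big_nat_recr//= leeDr// sume_ge0// => i _; rewrite lee_fin.
Qed.

Lemma l1dist_sym u v : l1dist u v = l1dist v u.
Proof.
congr (fine _); apply: (congr1 (fun f : nat -> \bar R => limn (fun n =>
  \sum_(1 <= l < n) f l)%E)).
by apply/funext => l; rewrite distrC.
Qed.

Lemma l1dist_triangle v u w : l1dist u w <= l1dist u v + l1dist v w.
Proof.
rewrite -lee_fin EFinD /l1dist !fineK ?l1norm_sub_fin// /l1norm.
rewrite -nneseriesD; try by move=> l _ _; rewrite lee_fin.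
apply: lee_nneseries => [l _ _|l _]; first by rewrite lee_fin.
by rewrite -EFinD lee_fin ler_distD.
Qed.

HB.instance Definition _ := @isMetric.Build R (Mplus R)
  l1dist l1dist_refl l1dist_eq0 l1dist_sym l1dist_triangle.

End Mplus_metric.

Section delta1.
Variable R : realType.

Definition delta1_fun (l : nat) : R := (l == 1%N)%:R.

Lemma delta1_ge0 l : 0 <= delta1_fun l. Proof. exact: ler0n. Qed.

Lemma delta1_le1 : (\sum_(1 <= l <oo) (delta1_fun l)%:E <= 1)%E.
Proof.
apply: lime_le.
  by apply: is_cvg_nneseries => l _ _; rewrite lee_fin.
near=> n.
rewrite sumEFin lee_fin (bigD1_seq 1%N) ?iota_uniq//=; last first.
  by rewrite mem_index_iota /=; near: n; exact: nbhs_infty_ge.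
by rewrite big1 ?addr0// /delta1_fun => i /negbTE ->.
Unshelve. all: by end_near. Qed.

Definition delta1 : Mplus R := MkMplus (erefl : delta1_fun 0%N = 0)
  delta1_ge0 delta1_le1.

End delta1.

Definition smoluchowski (R : realType) (K : nat -> nat -> R) (u : nat -> R)
    (l : nat) : R :=
  \sum_(1 <= i < l) K i (l - i)%N * u i * u (l - i)%N
  - 2 * \big[+%R/0]_(1 <= i <oo) (K l i * u l * u i).

(** The integral of an l^1-valued function is taken coordinatewise: for [u]
   continuous and [K] bounded, [s |-> smoluchowski K (u s)] is continuous in
   l^1, and the l-th coordinate of its integral is the integral of its l-th
   coordinate. *)
Definition weak_solution (R : realType) (K : nat -> nat -> R) (T : R)
    (u0 : Mplus R) (u : R -> Mplus R) : Prop :=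
  [/\ {within `[0, T], continuous u},
      u 0 = u0 &
      forall t : R, t \in `[0, T] -> forall l, (1 <= l)%N ->
        u t l = u 0 l
          + \int[lebesgue_measure]_(s in `[0, t]) smoluchowski K (u s) l].

(** Paths on [0, T] are functions on [R], whose values outside [0, T] are never
   used. *)

Definition cadlag (R : realType) (E : topologicalType) (T : R) (f : R -> E)
    : Prop :=
  (forall t : R, 0 <= t < T -> f s @[s --> t^'+] --> f t) /\
  (forall t : R, 0 < t <= T -> exists l : E, f s @[s --> t^'-] --> l).

Definition time_change (R : realType) (T : R) (lam : R -> R) : Prop :=
  [/\ {within `[0, T], continuous lam},
      {in `[0, T] &, {homo lam : s t / s < t}},
      lam 0 = 0 & lam T = T].

(** Skorohod's metric, which metrises the J_1 topology on càdlàg paths. *)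
Definition skorohod_dist (R : realType) (E : metricType R) (T : R)
    (f g : R -> E) : \bar R :=
  ereal_inf [set e%:E | e in [set e : R | exists2 lam, time_change T lam &
    forall t : R, t \in `[0, T] ->
      `|lam t - t| <= e /\ mdist (f t) (g (lam t)) <= e]].

(** Convergence in probability to a deterministic path for J_1. [mu_ext (P n)]
   is the outer measure of [P n], which is [P n] on measurable events
   ([measurable_mu_extE]); it spares the measurability of [skorohod_dist]. *)
Definition skorohod_cvg_in_probability (R : realType) (E : metricType R)
    (T : R) (d : nat -> measure_display)
    (Omega : forall n, measurableType (d n))
    (P : forall n, probability (Omega n) R)
    (X : forall n, R -> Omega n -> E) (x : R -> E) : Prop :=
  forall e : R, 0 < e ->
    mu_ext (P n) [set w | (e%:E <= skorohod_dist T (X n ^~ w) x)%E]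
      @[n --> \oo] --> 0%E.

(** Meant for a bounded generator [L], whose semigroup is [exp (t L)]:
   [transition L t z z'] is [(exp (t L) 1_{z'}) (z)]. *)
Definition transition (R : realType) (S : choiceType)
    (L : (S -> R) -> S -> R) (t : R) (z z' : S) : R :=
  \big[+%R/0]_(0 <= k <oo) (t ^+ k / k`!%:R * iter k L (fun y => (y == z')%:R) z).

Definition visits (R : realType) (S : choiceType) (Omega : Type)
    (X : R -> Omega -> S) (h : seq (R * S)) : set Omega :=
  [set w | forall p, p \in h -> X p.1 w = p.2].

(** The equations [mc_markov] are the Markov property with transition function
   [transition L], with the conditioning event multiplied out; [h] lists the
   values taken at finitely many times before [s]. *)
Record markov_chain (R : realType) (S : choiceType) (L : (S -> R) -> S -> R)
    (z0 : S) (d : measure_display) (Omega : measurableType d)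
    (P : probability Omega R) (X : R -> Omega -> S) : Prop := {
  mc_cadlag : forall w T, cadlag T (X ^~ w : R -> discrete_topology S) ;
  mc_measurable : forall (t : R) (z : S), 0 <= t -> measurable [set w | X t w = z] ;
  mc_init : P [set w | X 0 w = z0] = 1%E ;
  mc_markov : forall (h : seq (R * S)) (s t : R) (z z' : S),
    0 <= s -> 0 <= t -> (forall p, p \in h -> 0 <= p.1 <= s) ->
    P (visits X h `&` [set w | X s w = z] `&` [set w | X (s + t) w = z']) =
    (P (visits X h `&` [set w | X s w = z]) * (transition L t z z')%:E)%E }.

Definition config (n : nat) : Type := {ffun 'I_n -> nat}.
HB.instance Definition _ n := Countable.on (config n).

Definition monodisperse (n : nat) : config n := [ffun=> 1%N].

(** [eta + eta_x (delta_y - delta_x)]; the truncated subtraction is exact. *)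
Definition coalesce (n : nat) (eta : config n) (x y : 'I_n) : config n :=
  [ffun z => (eta z + eta x * (z == y) - eta x * (z == x))%N].

Definition ml_generator (R : realType) (K : nat -> nat -> R) (n : nat)
    (f : config n -> R) (eta : config n) : R :=
  n%:R^-1 * \sum_(x < n) \sum_(y < n | y != x)
    K (eta x) (eta y) * (f (coalesce eta x y) - f eta).

Section empirical.
Variables (R : realType) (n : nat) (eta : config n).

Definition empirical_fun (l : nat) : R :=
  if l == 0%N then 0 else #|[pred x | eta x == l]|%:R / n%:R.

Lemma empirical_ge0 l : 0 <= empirical_fun l.
Proof. by rewrite /empirical_fun; case: ifP => // _; rewrite divr_ge0. Qed.

Lemma empirical_le1 : (\sum_(1 <= l <oo) (empirical_fun l)%:E <= 1)%E.
Proof.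
apply: lime_le.
  by apply: is_cvg_nneseries => l _ _; rewrite lee_fin empirical_ge0.
near=> N.
rewrite sumEFin lee_fin.
have -> : \sum_(1 <= l < N) empirical_fun l =
    (\sum_(1 <= l < N) #|[pred x | eta x == l]|)%:R / n%:R.
  rewrite natr_sum mulr_suml; apply: eq_big_nat => l /andP[l1 _].
  by rewrite /empirical_fun eqn0Ngt l1.
have [n0|n0] := posnP n; first by rewrite [X in _ / X%:R]n0 invr0 mulr0.
rewrite ler_pdivrMr ?ltr0n// mul1r ler_nat.
under eq_bigr do rewrite -sum1_card.
under eq_bigr do rewrite big_mkcond.
rewrite exchange_big/= -[leqRHS]card_ord -sum1_card.
apply: leq_sum => x _.
under eq_bigr do rewrite inE.
rewrite -big_mkcond/= -big_filter sum1_size size_filter.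
rewrite (eq_count (a2 := pred1 (eta x))); last by move=> l; rewrite /= eq_sym.
by rewrite count_uniq_mem ?iota_uniq// leq_b1.
Unshelve. all: by end_near. Qed.

Definition empirical : Mplus R := MkMplus (erefl : empirical_fun 0%N = 0)
  empirical_ge0 empirical_le1.

End empirical.

(* Main.v *)
Require Import Defs.
From HB Require Import structures.
From mathcomp Require Import all_boot all_order all_algebra.
From mathcomp Require Import all_classical all_reals all_analysis.
From mathcomp Require Import ring lra zify.
Set Implicit Arguments.
Unset Strict Implicit.
Unset Printing Implicit Defensive.

Import Order.TTheory GRing.Theory Num.Theory.
Import numFieldNormedType.Exports.
Local Open Scope classical_set_scope.
Local Open Scope ring_scope.

(** The density of the particle system solves the Smoluchowski equation up to a
noise of variance of order 1/n, so a Grönwall argument gives the law of large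
numbers at fixed times; the number of clusters being monotone, this upgrades to
uniform convergence in time, hence to J_1 convergence, without any maximal
inequality.

The equation. The Smoluchowski operator is Lipschitz for the l^1 norm on
densities of mass at most one ([smol_lip]). Its explicit Euler scheme started
from [delta1] stays among finitely supported densities with first moment at most
one ([euler_fin_density]); halving the step moves the scheme by at most a
multiple of the step ([euler_path_halve]), so the dyadic schemes converge to a path [flow] whose
Taylor expansion at every time has first-order term the Smoluchowski operator
([flow_taylor]). This expansion is the working form of the equation: it gives
the derivative, hence the integral equation ([solution_weak]), and every weak
solution satisfies it ([weak_taylor]), so that Grönwall's lemma along finer and
finer grids gives uniqueness ([weak_unique]).

Fixed times. The distance between the empirical density and the Euler scheme is
measured by [sqdist], the l^2 norm with weight l^2. The weight is strong enough to
dominate the l^1 norm, and the Smoluchowski operator satisfies a one-sided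
Lipschitz bound for it on densities with first moment at most one
([smol_one_sided_lip]). The generator applied to [sqdist] is twice this pairing
plus a noise of order 1/n times the second moment, itself of bounded growth;
their combination [lyapunov] therefore grows at most exponentially
([lyapunov_step]). Since the chain never leaves the finite set of configurations
of mass n, its semigroup is the exponential of a bounded operator, and one time
step costs an error of second order in the step, for fixed n
([transition_taylor]). Iterating over the Euler scheme ([expect_lyapunov]) and
letting the step go to 0 gives the quantitative [law_large_numbers].

Uniformity in time. As the kernel vanishes on empty sites, every jump removes
exactly one cluster and moves the density by at most 3/n in l^1. Almost surely
this holds along the whole path ([paths_reach]), so the oscillation of the
density over a time interval is at most three times the decrease of the density
of clusters, which is itself read off from the densities at the two endpoints.
Closeness at the points of a finite grid thus implies uniform closeness
([uniform_of_grid]), and the identity serves as time change. *)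

(** * A discrete Grönwall lemma *)

Section gronwall.
Variable R : realType.

Lemma discrete_gronwall (A B : R) (d : nat -> R) : 0 <= A -> 0 <= B ->
  0 <= d 0%N -> (forall k, d k.+1 <= (1 + A) * d k + B) ->
  forall k, d k <= expR (A * k%:R) * (d 0%N + B * k%:R).
Proof.
move=> A0 B0 d0 dS; elim=> [|k IH]; first by rewrite !mulr0 expR0 mul1r addr0.
apply: le_trans (dS k) _.
have kE : k.+1%:R = k%:R + 1 :> R by rewrite natr1.
have H1 : (1 + A) * d k <= expR (A * k.+1%:R) * (d 0%N + B * k%:R).
  rewrite kE [A * _]mulrDr mulr1 expRD [_ * expR A]mulrC -mulrA.
  apply: le_trans (_ : (1 + A) * (expR (A * k%:R) * (d 0%N + B * k%:R)) <= _).
    by rewrite ler_wpM2l// addr_ge0.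
  rewrite ler_wpM2r ?expR_ge1Dx//.
  by rewrite mulr_ge0 ?expR_ge0// addr_ge0// mulr_ge0.
have H2 : B <= expR (A * k.+1%:R) * B.
  rewrite ler_peMl// -expR0 ler_expR mulr_ge0//.
apply: le_trans (lerD H1 H2) _.
by rewrite -mulrDr [in B * k.+1%:R]kE [B * (_ + 1)]mulrDr mulr1 addrA.
Qed.

End gronwall.

(** * Bounds on partial sums and infinite sums *)

Section l1.
Variable R : realType.
Implicit Types (f g : nat -> R) (b : R).

(** Bounds on all partial sums replace an extended-real norm. *)
Definition l1le f b := forall N, \sum_(l < N) `|f l| <= b.

Lemma l1le_ge0 f b : l1le f b -> 0 <= b.
Proof. by move/(_ 0%N); rewrite big_ord0. Qed.

Lemma l1le_coord f b : l1le f b -> forall l, `|f l| <= b.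
Proof.
by move=> fb l; apply: le_trans (fb l.+1); rewrite big_ord_recr/= lerDr sumr_ge0.
Qed.

Lemma l1le_le f b c : l1le f b -> b <= c -> l1le f c.
Proof. by move=> fb bc N; apply: le_trans (fb N) bc. Qed.

Lemma eq_l1le f g b : f =1 g -> l1le f b -> l1le g b.
Proof. by move=> fg fb N; under eq_bigr do rewrite -fg. Qed.

Lemma l1le_dom f g b : (forall l, `|f l| <= `|g l|) -> l1le g b -> l1le f b.
Proof. by move=> fg gb N; apply: le_trans (gb N); apply: ler_sum => i _. Qed.

Lemma l1leD f g b c : l1le f b -> l1le g c -> l1le (fun l => f l + g l) (b + c).
Proof.
move=> fb gc N; apply: le_trans (lerD (fb N) (gc N)); rewrite -big_split/=.
by apply: ler_sum => i _; rewrite ler_normD.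
Qed.

Lemma l1leN f b : l1le f b -> l1le (fun l => - f l) b.
Proof. by apply: l1le_dom => l; rewrite normrN. Qed.

Lemma l1leB f g b c : l1le f b -> l1le g c -> l1le (fun l => f l - g l) (b + c).
Proof. by move=> fb /l1leN; exact: l1leD. Qed.

Lemma l1leM f b c : l1le f b -> l1le (fun l => c * f l) (`|c| * b).
Proof.
move=> fb N; under eq_bigr do rewrite normrM.
by rewrite -mulr_sumr ler_wpM2l.
Qed.

Lemma l1le_triangle g f h b c : l1le (fun l => f l - g l) b ->
  l1le (fun l => g l - h l) c -> l1le (fun l => f l - h l) (b + c).
Proof. by move=> fb gc; apply: eq_l1le (l1leD fb gc) => l /=; ring. Qed.

Lemma cvg_sum_ord (I : Type) (G : set_system I) {_ : Filter G} (F : I -> nat -> R) f :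
  (forall l, F m l @[m --> G] --> f l) ->
  forall N, \sum_(l < N) F m l @[m --> G] --> \sum_(l < N) f l.
Proof.
move=> Ff; elim=> [|N IH].
  by rewrite big_ord0; apply: cvg_near_cst; near=> m; rewrite big_ord0.
rewrite big_ord_recr/=.
by under eq_fun do rewrite big_ord_recr/=; apply: cvgD.
Unshelve. all: by end_near. Qed.

Lemma l1le_cvg (F : nat -> nat -> R) (c : nat -> R) f b :
  (forall l, F m l @[m --> \oo] --> f l) -> c @ \oo --> b ->
  (\forall m \near \oo, l1le (F m) (c m)) -> l1le f b.
Proof.
move=> Ff cb Fc N.
have cv : (fun m => \sum_(l < N) `|F m l|) @ \oo --> \sum_(l < N) `|f l|.
  apply: (@cvg_sum_ord _ \oo _ (fun m l => `|F m l|) (fun l => `|f l|)) => l.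
  by apply: cvg_norm; exact: Ff.
by apply: ler_cvg_to cv cb _; near=> m; near: m; apply: filterS Fc => m; exact.
Unshelve. all: by end_near. Qed.

Definition isum f : R := limn (fun n => \sum_(i < n) f i).

Lemma isum_cvg f b : l1le f b -> (fun n => \sum_(i < n) f i) @ \oo --> isum f.
Proof.
move=> fb.
suff : cvgn (series f).
  rewrite (_ : series f = fun n => \sum_(i < n) f i)//.
  by rewrite seriesEord.
apply: normed_cvg.
rewrite (_ : [normed series f] = fun n => \sum_(i < n) `|f i|); last first.
  by rewrite -[LHS]/(series (fun i => `|f i|)) seriesEord.
apply: nondecreasing_is_cvgn.
  move=> m n mn.
  by rewrite -(subnKC mn) big_split_ord/= lerDl sumr_ge0.
by exists b => _ [n _ <-] /=; exact: fb.
Qed.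

Lemma isum_norm_le f b : l1le f b -> `|isum f| <= b.
Proof.
move=> fb.
have cv : (fun n => `|\sum_(i < n) f i|) @ \oo --> `|isum f|.
  by apply: cvg_norm; exact: isum_cvg fb.
rewrite -(cvg_lim _ cv)//; apply: limr_le; first by apply/cvg_ex; exists `|isum f|.
by near=> n; apply: le_trans (ler_norm_sum _ _ _) (fb n).
Unshelve. all: by end_near. Qed.

Lemma isumB f g b c : l1le f b -> l1le g c ->
  isum (fun l => f l - g l) = isum f - isum g.
Proof.
move=> fb gc; apply: cvg_lim => //.
under eq_fun do rewrite sumrB.
by apply: cvgB; [exact: isum_cvg fb|exact: isum_cvg gc].
Qed.

Lemma isumM f b c : l1le f b -> isum (fun l => c * f l) = c * isum f.
Proof.
move=> fb; apply: cvg_lim => //.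
under eq_fun do rewrite -mulr_sumr.
by apply: cvgMl_tmp; exact: isum_cvg fb.
Qed.

Lemma le_isum f b N : (forall l, 0 <= f l) -> l1le f b ->
  \sum_(i < N) f i <= isum f.
Proof.
move=> f0 fb.
apply: limr_ge; first by apply/cvg_ex; exists (isum f); exact: isum_cvg fb.
near=> n; have Nn : (N <= n)%N by near: n; exact: nbhs_infty_ge.
by rewrite -(subnKC Nn) big_split_ord/= lerDl sumr_ge0.
Unshelve. all: by end_near. Qed.

Lemma isum_fin f N : (forall i, (N <= i)%N -> f i = 0) ->
  isum f = \sum_(i < N) f i.
Proof.
move=> fN; apply: cvg_lim => //.
apply: cvg_near_cst; near=> n.
have Nn : (N <= n)%N by near: n; exact: nbhs_infty_ge.
rewrite -(subnKC Nn) big_split_ord/= [X in _ + X]big1 ?addr0// => i _.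
by rewrite fN// leq_addr.
Unshelve. all: by end_near. Qed.

End l1.

(** * Densities of mass at most one *)

Section Mplus_l1.
Variable R : realType.
Implicit Types (f g : nat -> R) (b : R) (u v : Mplus R).

Definition subprob f := [/\ f 0%N = 0, (forall l, 0 <= f l) & l1le f 1].

(** The two families start at different indices, hence the condition at 0. *)
Lemma l1norm_leP f b : f 0%N = 0 -> (l1norm f <= b%:E)%E <-> l1le f b.
Proof.
move=> f0.
have E n : (\sum_(1 <= l < n.+1) `|f l|%:E)%E = (\sum_(l < n.+1) `|f l|)%:E.
  by rewrite -(big_mkord xpredT (fun l => `|f l|)) big_ltn// f0 normr0 add0r sumEFin.
have h n : (1 <= n)%N -> xpredT n -> (0 <= `|f n|%:E)%E by rewrite lee_fin.
split=> [fb [|N]|fb].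
- rewrite big_ord0 -lee_fin; apply: le_trans fb.
  by apply: nneseries_ge0 => l _ _; rewrite lee_fin.
- by rewrite -lee_fin -E; apply: le_trans fb; exact: nneseries_lim_ge.
- apply: lime_le; first exact: is_cvg_nneseries.
  near=> n; have /prednK <- : (0 < n)%N by near: n; exact: nbhs_infty_gt.
  by rewrite E lee_fin.
Unshelve. all: by end_near. Qed.

Lemma Mplus_subprob u : subprob u.
Proof.
split; [exact: density0|exact: density_ge0|].
apply/l1norm_leP; first exact: density0.
apply: le_trans (density_le1 u); apply: lee_nneseries => // l _.
by rewrite ger0_norm// density_ge0.
Qed.

Lemma subprob_le1 f : subprob f -> (\sum_(1 <= l <oo) (f l)%:E <= 1)%E.
Proof.
move=> [f0 fp /l1norm_leP-/(_ f0)]; apply: le_trans.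
by apply: lee_nneseries => // l _; rewrite ?lee_fin// ger0_norm.
Qed.

Definition Mplus_of f (h : subprob f) : Mplus R :=
  MkMplus (let: And3 h0 _ _ := h in h0) (let: And3 _ h1 _ := h in h1)
    (subprob_le1 h).

Lemma l1dist_leP u v b : l1dist u v <= b <-> l1le (fun l => u l - v l) b.
Proof.
rewrite -l1norm_leP; last by rewrite !density0 subrr.
by rewrite -(fineK (l1norm_sub_fin u v)) lee_fin.
Qed.

Lemma l1le_l1dist u v : l1le (fun l => u l - v l) (l1dist u v).
Proof. exact/l1dist_leP. Qed.

End Mplus_l1.

(** * Finite convolution sums *)

Section sums.
Variable R : realType.

Lemma sum_supp (F : nat -> R) N M : (forall i, (N <= i)%N -> F i = 0) ->
  (N <= M)%N -> \sum_(i < M) F i = \sum_(i < N) F i.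
Proof.
move=> F0 NM; rewrite -(subnKC NM) big_split_ord/= [X in _ + X]big1 ?addr0// => i _.
by rewrite F0// leq_addr.
Qed.

Lemma ler_sum_ord_widen (F : nat -> R) N M : (forall i, 0 <= F i) ->
  (N <= M)%N -> \sum_(i < N) F i <= \sum_(i < M) F i.
Proof. by move=> F0 NM; rewrite -(subnKC NM) big_split_ord/= lerDl sumr_ge0. Qed.

Lemma antidiagonal_sum (F : nat -> nat -> R) N :
  \sum_(l < N) \sum_(i < l.+1) F i (l - i)%N =
  \sum_(i < N) \sum_(j < N - i) F i j.
Proof.
elim: N => [|N IH]; first by rewrite !big_ord0.
rewrite big_ord_recr/= IH [RHS]big_ord_recr/= subSnn big_ord1.
rewrite big_ord_recr/= subnn addrA; congr (_ + _).
rewrite -big_split/=; apply: eq_bigr => i _.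
by rewrite subSn ?(ltnW (ltn_ord i))// big_ord_recr.
Qed.

Lemma conv_le (a b : nat -> R) N : (forall i, 0 <= a i) -> (forall i, 0 <= b i) ->
  \sum_(l < N) \sum_(i < l.+1) a i * b (l - i)%N <=
  (\sum_(i < N) a i) * (\sum_(i < N) b i).
Proof.
move=> a0 b0; rewrite (antidiagonal_sum (fun i j => a i * b j)) mulr_suml.
apply: ler_sum => i _; rewrite -mulr_sumr ler_wpM2l//.
by apply: ler_sum_ord_widen => //; rewrite leq_subr.
Qed.

End sums.

(** * The Smoluchowski operator in l^1 *)

Section smoluchowski.
Variables (R : realType) (K : nat -> nat -> R) (C : R).
Hypothesis K_ge0 : forall i j, 0 <= K i j.
Hypothesis K_sym : forall i j, K i j = K j i.
Hypothesis K_le : forall i j, K i j <= C.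
Hypothesis K_0 : forall l, K 0%N l = 0.
Implicit Types (f g : nat -> R).

Lemma kernel_bound_ge0 : 0 <= C.
Proof. exact: le_trans (K_ge0 0 0) (K_le 0 0). Qed.
Let C0 := kernel_bound_ge0.

(** Half of the loss rate of a cluster of size [l]: pairs of sites are ordered. *)
Definition hit_rate f l := isum (fun i => K l i * f i).

Lemma l1le_K f b l : l1le f b -> l1le (fun i => K l i * f i) (C * b).
Proof.
move=> fb N; apply: le_trans (_ : C * \sum_(i < N) `|f i| <= _).
  rewrite mulr_sumr; apply: ler_sum => i _.
  by rewrite normrM ger0_norm// ler_wpM2r.
by rewrite ler_wpM2l.
Qed.

Lemma smolE f b l : l1le f b -> smoluchowski K f l =
  \sum_(i < l.+1) K i (l - i)%N * f i * f (l - i)%N - 2 * (f l * hit_rate f l).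
Proof.
move=> fb; rewrite /smoluchowski; congr (_ - 2 * _).
  rewrite big_ord_recr/= subnn K_sym K_0 !mul0r addr0.
  case: l => [|l]; first by rewrite big_geq// big_ord0.
  rewrite -(big_mkord xpredT (fun i => K i (l.+1 - i)%N * f i * f (l.+1 - i)%N)).
  by rewrite [RHS]big_ltn// K_0 !mul0r add0r.
rewrite /hit_rate -(isumM _ (l1le_K l fb)) /isum.
apply: (congr1 (fun h : nat -> R => limn h)); apply/funext => -[|n].
  by rewrite big_geq// big_ord0.
rewrite -(big_mkord xpredT (fun i => f l * (K l i * f i))) [RHS]big_ltn//.
rewrite K_sym K_0 mul0r mulr0 add0r; apply: eq_bigr => i _.
by rewrite mulrCA mulrA.
Qed.

Lemma hit_rate_norm f b l : l1le f b -> `|hit_rate f l| <= C * b.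
Proof. by move=> fb; apply: isum_norm_le; exact: l1le_K. Qed.

Lemma hit_rateB f g b c e l : l1le f b -> l1le g c -> l1le (fun l => f l - g l) e ->
  `|hit_rate f l - hit_rate g l| <= C * e.
Proof.
move=> fb gc de; rewrite /hit_rate -(isumB (l1le_K l fb) (l1le_K l gc)).
by apply: isum_norm_le; apply: eq_l1le (l1le_K l de) => i; rewrite mulrBr.
Qed.

(** A quadratic map with bounded coefficients: every difference of products has
   one factor [f - g] and one factor of mass at most one. The gain contributes
   [2 * C] and the loss [4 * C]. *)
Lemma smol_lip f g e : subprob f -> subprob g ->
  l1le (fun l => f l - g l) e ->
  l1le (fun l => smoluchowski K f l - smoluchowski K g l) (6 * C * e).
Proof.
move=> [f0 fp f1] [g0 gp g1] de N; have e0 := l1le_ge0 de.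
set d := fun l => `|f l - g l|.
have bnd l : `|smoluchowski K f l - smoluchowski K g l| <=
    C * (\sum_(i < l.+1) d i * f (l - i)%N) +
    C * (\sum_(i < l.+1) g i * d (l - i)%N) + 2 * C * d l + 2 * C * e * g l.
  rewrite (smolE l f1) (smolE l g1).
  rewrite (_ : _ - _ = (\sum_(i < l.+1) K i (l - i)%N * f i * f (l - i)%N
    - \sum_(i < l.+1) K i (l - i)%N * g i * g (l - i)%N)
    - (2 * (f l - g l) * hit_rate f l + 2 * g l * (hit_rate f l - hit_rate g l)));
    last by ring.
  apply: le_trans (ler_normB _ _) _; rewrite -addrA; apply: lerD.
    rewrite -sumrB; apply: le_trans (ler_norm_sum _ _ _) _.
    rewrite !mulr_sumr -big_split/=; apply: ler_sum => i _.
    rewrite (_ : _ - _ = K i (l - i)%N * ((f i - g i) * f (l - i)%N +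
      g i * (f (l - i)%N - g (l - i)%N))); last by ring.
    rewrite -mulrDr normrM (ger0_norm (K_ge0 _ _)).
    apply: ler_pM => //; apply: le_trans (ler_normD _ _) _.
    by rewrite !normrM (ger0_norm (fp _)) (ger0_norm (gp _)).
  apply: le_trans (ler_normD _ _) _; rewrite !normrM.
  rewrite (ger0_norm (gp _)) [`|2|]ger0_norm//; apply: lerD.
    rewrite -mulrA -[2 * C * _]mulrA ler_wpM2l// mulrC ler_wpM2r//.
    by have := hit_rate_norm l f1; rewrite mulr1.
  rewrite -!mulrA ler_wpM2l// mulrC mulrA ler_wpM2r//.
  exact: hit_rateB f1 g1 de.
apply: le_trans (ler_sum _ _) _; first by move=> i _; exact: bnd.
rewrite !big_split/= -!mulr_sumr.
have S1 : \sum_(l < N) d l <= e by exact: de.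
have S2 : \sum_(l < N) g l <= 1.
  by apply: le_trans (g1 N); apply: ler_sum => i _; rewrite ler_norm.
have S3 : \sum_(l < N) f l <= 1.
  by apply: le_trans (f1 N); apply: ler_sum => i _; rewrite ler_norm.
have d0 i : 0 <= d i by rewrite normr_ge0.
have E1 : C * \sum_(l < N) \sum_(i < l.+1) d i * f (l - i)%N <= C * e.
  rewrite ler_wpM2l//; apply: le_trans (conv_le _ d0 fp) _.
  by rewrite -[e]mulr1; apply: ler_pM => //; rewrite sumr_ge0.
have E2 : C * \sum_(l < N) \sum_(i < l.+1) g i * d (l - i)%N <= C * e.
  rewrite ler_wpM2l//; apply: le_trans (conv_le _ gp d0) _.
  by rewrite -[e]mul1r; apply: ler_pM => //; rewrite sumr_ge0.
have E3 : 2 * C * \sum_(l < N) d l <= 2 * C * e by rewrite ler_wpM2l// mulr_ge0.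
have E4 : 2 * C * e * \sum_(l < N) g l <= 2 * C * e.
  by rewrite -[leRHS]mulr1 ler_wpM2l// !mulr_ge0.
lra.
Qed.

Lemma subprob0 : subprob (fun=> 0 : R).
Proof. by split=> // N; rewrite big1// => i _; rewrite normr0. Qed.

Lemma smol0 l : smoluchowski K (fun=> 0) l = 0.
Proof.
rewrite (smolE (b := 1)); last by case: subprob0.
by rewrite mul0r mulr0 subr0 big1// => i _; rewrite mulr0.
Qed.

Lemma smol_bound f : subprob f -> l1le (smoluchowski K f) (6 * C).
Proof.
move=> fs; rewrite -[6 * C]mulr1; have [_ _ f1] := fs.
apply: eq_l1le (smol_lip fs subprob0 _) => [l /=|].
  by rewrite smol0 subr0.
by apply: eq_l1le f1 => l; rewrite subr0.
Qed.

End smoluchowski.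

(** * The Euler scheme *)

Section euler.
Variables (R : realType) (K : nat -> nat -> R) (C : R).
Hypothesis K_ge0 : forall i j, 0 <= K i j.
Hypothesis K_sym : forall i j, K i j = K j i.
Hypothesis K_le : forall i j, K i j <= C.
Hypothesis K_0 : forall l, K 0%N l = 0.
Implicit Types (f g : nat -> R).
Let C0 : 0 <= C := kernel_bound_ge0 K_ge0 K_le.

Lemma supp_l1le f N : (forall i, (N <= i)%N -> f i = 0) ->
  l1le f (\sum_(i < N) `|f i|).
Proof.
move=> fN M; apply: le_trans (_ : \sum_(i < maxn M N) `|f i| <= _).
  by apply: (ler_sum_ord_widen (F := fun i => `|f i|)) => //; exact: leq_maxl.
rewrite (sum_supp (F := fun i => `|f i|) (N := N)) ?leq_maxr// => i Ni.
by rewrite fN// normr0.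
Qed.

(** Each ordered pair of clusters of sizes i and j is replaced by one cluster of
   size i + j; the loss is symmetrised. *)
Lemma smol_weak f N M (phi : nat -> R) : (forall i, (N <= i)%N -> f i = 0) ->
  (N + N <= M)%N ->
  \sum_(l < M) phi l * smoluchowski K f l = \sum_(i < N) \sum_(j < N)
    K i j * f i * f j * (phi (i + j)%N - phi i - phi j).
Proof.
move=> fN NM; have NM' : (N <= M)%N by lia.
pose F (i j : nat) := K i j * f i * f j.
have gain : \sum_(l < M) phi l * (\sum_(i < l.+1) F i (l - i)%N) =
    \sum_(i < N) \sum_(j < N) F i j * phi (i + j)%N.
  rewrite (eq_bigr (fun l : 'I_M => \sum_(i < l.+1)
      F i (l - i)%N * phi (i + (l - i))%N)); last first.
    move=> l _; rewrite mulr_sumr; apply: eq_bigr => i _.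
    have il : (i <= l)%N by rewrite -ltnS.
    by rewrite (subnKC il) mulrC.
  rewrite (antidiagonal_sum (fun i j => F i j * phi (i + j)%N)).
  rewrite (@sum_supp _ (fun i => \sum_(j < M - i) F i j * phi (i + j)%N) N)//.
    apply: eq_bigr => i _; apply: (@sum_supp _ (fun j => F i j * phi (i + j)%N)).
      by move=> j Nj; rewrite /F (fN j)// mulr0 mul0r.
    by have := ltn_ord i; lia.
  by move=> i Ni; rewrite big1// => j _; rewrite /F fN// mulr0 !mul0r.
have loss : \sum_(l < M) phi l * (f l * hit_rate K f l) =
    \sum_(i < N) \sum_(j < N) F i j * phi i.
  rewrite (@sum_supp _ (fun l => phi l * (f l * hit_rate K f l)) N)//; last first.
    by move=> i Ni; rewrite fN// mul0r mulr0.
  apply: eq_bigr => i _; rewrite /hit_rate (@isum_fin _ _ N).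
    rewrite !mulr_sumr; apply: eq_bigr => j _; rewrite /F; ring.
  by move=> j Nj; rewrite fN// mulr0.
have loss' : \sum_(i < N) \sum_(j < N) F i j * phi j =
    \sum_(i < N) \sum_(j < N) F i j * phi i.
  rewrite exchange_big/=; apply: eq_bigr => i _; apply: eq_bigr => j _.
  by rewrite /F K_sym; ring.
under eq_bigr do rewrite (smolE K_ge0 K_sym K_le K_0 _ (supp_l1le fN)) mulrBr.
rewrite sumrB gain.
rewrite (_ : \sum_(l < M) phi l * (2 * (f l * hit_rate K f l)) =
  \sum_(l < M) phi l * (f l * hit_rate K f l) +
  \sum_(l < M) phi l * (f l * hit_rate K f l)); last first.
  by rewrite -big_split/=; apply: eq_bigr => i _; ring.
rewrite loss -{2}loss' opprD addrA -!sumrB; apply: eq_bigr => i _.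
by rewrite -!sumrB; apply: eq_bigr => j _; rewrite /F; ring.
Qed.

(** The class in which the Euler scheme started from [delta1] lives: there, unlike
   for the solution, all the sums are finite. The bound on the first moment is
   what controls the quadratic terms in weighted norms. *)
Definition fin_density f := [/\ f 0%N = 0, (forall l, 0 <= f l),
  (exists N, forall i, (N <= i)%N -> f i = 0) & l1le (fun l => l%:R * f l) 1].

Lemma fin_density_subprob f : fin_density f -> subprob f.
Proof.
move=> [f0 fp _ f1]; split => //; apply: l1le_dom f1 => -[|l].
  by rewrite f0 normr0.
by rewrite normrM ler_peMl// ger0_norm// ler1n.
Qed.

Lemma l1le_sum f b N : l1le f b -> \sum_(i < N) f i <= b.
Proof. by move=> fb; apply: le_trans (fb N); apply: ler_sum => i _; exact: ler_norm. Qed.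

Definition euler h f l := f l + h * smoluchowski K f l.

Lemma smol_supp f N : (forall i, (N <= i)%N -> f i = 0) ->
  forall i, (N + N <= i)%N -> smoluchowski K f i = 0.
Proof.
move=> fN i Ni; have := @smol_weak f N i.+1 (fun l => (l == i)%:R) fN.
rewrite big_ord_recr/= eqxx mul1r big1 ?add0r; last first.
  by move=> j _; rewrite ltn_eqF ?mul0r// ltn_ord.
move=> -> //; last by lia.
rewrite big1// => j _; rewrite big1// => k _.
have := ltn_ord j; have := ltn_ord k => kN jN.
by rewrite !ltn_eqF ?subr0 ?mulr0//; lia.
Qed.

(** Test the weak form against [l] times the sign of the left-hand side: the
   bracket is then at most 2(i + j) in absolute value. *)
Lemma smol_moment f : fin_density f -> l1le (fun l => l%:R * smoluchowski K f l) (4 * C).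
Proof.
move=> fg; have [f0 fp [N fN] f1] := fg; have [_ _ fl1] := fin_density_subprob fg.
move=> M0; pose M := maxn M0 (N + N).
apply: le_trans (_ : \sum_(l < M) `|l%:R * smoluchowski K f l| <= _).
  apply: (ler_sum_ord_widen (F := fun l => `|l%:R * smoluchowski K f l|)) => //.
  exact: leq_maxl.
pose phi l : R := l%:R * Num.sg (smoluchowski K f l).
have phiE l : `|phi l| <= l%:R by rewrite normrM normr_nat normr_sg ler_piMr// lern1 leq_b1.
rewrite (eq_bigr (fun l : 'I_M => phi l * smoluchowski K f l)); last first.
  by move=> l _; rewrite normrM normr_nat -mulrA -normrEsg.
rewrite (smol_weak phi fN) ?leq_maxr//.
apply: le_trans (_ : \sum_(i < N) \sum_(j < N)
  2 * C * (i%:R * f i * f j + f i * (j%:R * f j)) <= _).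
  apply: ler_sum => i _; apply: ler_sum => j _.
  have := phiE (i + j)%N; have := phiE i; have := phiE j.
  rewrite natrD !ler_norml => /andP[a1 a2] /andP[a3 a4] /andP[a5 a6].
  rewrite [leRHS](_ : _ = C * (f i * f j * (2 * (i%:R + j%:R)))); last by ring.
  rewrite -2!(mulrA (K i j)).
  apply: le_trans (_ : K i j * (f i * f j * (2 * (i%:R + j%:R))) <= _).
    by rewrite ler_wpM2l// ler_wpM2l ?mulr_ge0//; lra.
  by rewrite ler_wpM2r// !mulr_ge0.
under eq_bigr do rewrite -mulr_sumr big_split/= -!mulr_sumr.
rewrite -mulr_sumr big_split/= -!mulr_suml.
have := l1le_sum N f1; have := l1le_sum N fl1.
set a := \sum_(i < N) f i; set b := \sum_(i < N) _ => a1 b1.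
have a0 : 0 <= a by apply: sumr_ge0.
have b0 : 0 <= b by apply: sumr_ge0 => i _; rewrite mulr_ge0.
have : C * (a * b) <= C by rewrite ler_piMr// mulr_ile1.
nra.
Qed.

(** The loss term is at most [2 * C] times the density, whence positivity for
   small steps; coalescence conserves the first moment. *)
Lemma euler_fin_density h f : 0 <= h -> 2 * C * h <= 1 -> fin_density f -> fin_density (euler h f).
Proof.
move=> h0 hC fg; have [f0 fp [N fN] f1] := fg; have fs := fin_density_subprob fg.
have [_ _ fl1] := fs.
have sp l : 0 <= euler h f l.
  rewrite /euler (smolE K_ge0 K_sym K_le K_0 _ fl1).
  have := hit_rate_norm K_ge0 K_le l fl1; rewrite mulr1 ler_norml => /andP[_ H].
  have S0 : 0 <= \sum_(i < l.+1) K i (l - i)%N * f i * f (l - i)%N.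
    by apply: sumr_ge0 => i _; rewrite !mulr_ge0.
  move: S0 H; set S := \sum_(_ < _) _; set A := hit_rate K f l => S0 H.
  rewrite (_ : _ + _ = f l * (1 - h * (2 * A)) + h * S); last by ring.
  by rewrite addr_ge0// mulr_ge0//; nra.
have eN i : (N + N <= i)%N -> euler h f i = 0.
  by move=> Ni; rewrite /euler (smol_supp fN)// mulr0 addr0 fN//; lia.
split=> //.
- by rewrite /euler f0 (smolE K_ge0 K_sym K_le K_0 _ fl1) big_ord1 K_0 f0; ring.
- by exists (N + N)%N.
- move=> M0; pose M := maxn M0 (N + N).
  apply: le_trans (_ : \sum_(l < M) `|l%:R * euler h f l| <= _).
    apply: (ler_sum_ord_widen (F := fun l => `|l%:R * euler h f l|)) => //.
    exact: leq_maxl.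
  rewrite (eq_bigr (fun l : 'I_M => l%:R * f l + h * (l%:R * smoluchowski K f l))); last first.
    by move=> l _; rewrite normrM normr_nat (ger0_norm (sp l)) /euler; ring.
  rewrite big_split/= -mulr_sumr (smol_weak (fun l => l%:R) fN) ?leq_maxr//.
  rewrite [X in h * X]big1 ?mulr0 ?addr0; first exact: l1le_sum f1.
  by move=> i _; rewrite big1// => j _; rewrite natrD; ring.
Qed.

Lemma delta1_fin_density : fin_density (delta1 R).
Proof.
split.
- exact: density0.
- exact: density_ge0.
- by exists 2%N => -[|[|i]].
- move=> N; apply: le_trans (_ : \sum_(i < N) (i == 1%N :> nat)%:R <= _).
    apply: ler_sum => i _; rewrite /= /delta1_fun.
    by case: eqP => [->|_]; rewrite ?mulr1 ?mulr0 ?normr0 ?normr1.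
  case: N => [|[|N]]; first by rewrite big_ord0.
    by rewrite big_ord1.
  by rewrite !big_ord_recl/= big1 ?addr0 ?add0r.
Qed.

Lemma euler_l1 h f g e : 0 <= h -> subprob f -> subprob g ->
  l1le (fun l => f l - g l) e ->
  l1le (fun l => euler h f l - euler h g l) ((1 + 6 * C * h) * e).
Proof.
move=> h0 fs gs de.
have := l1leD de (l1leM h (smol_lip K_ge0 K_sym K_le K_0 fs gs de)).
rewrite ger0_norm// => H; apply: l1le_le (eq_l1le _ H) _ => [l/=|].
  by rewrite /euler; ring.
by rewrite le_eqVlt; apply/orP; left; apply/eqP; ring.
Qed.

Definition euler_path h k : nat -> R := iter k (euler h) (delta1 R).

Lemma euler_path_fin_density h k : 0 <= h -> 2 * C * h <= 1 -> fin_density (euler_path h k).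
Proof.
move=> h0 hC; elim: k => [|k IH]; first exact: delta1_fin_density.
exact: euler_fin_density.
Qed.

Lemma euler_path_lip h k j : 0 <= h -> 2 * C * h <= 1 ->
  l1le (fun l => euler_path h (k + j) l - euler_path h k l) (6 * C * (j%:R * h)).
Proof.
move=> h0 hC; elim: j => [|j IH].
  by move=> N; rewrite addn0 big1 ?mul0r ?mulr0// => i _; rewrite subrr normr0.
have := smol_bound K_ge0 K_sym K_le K_0 (fin_density_subprob (euler_path_fin_density (k + j) h0 hC)).
move=> /(l1leM h)/(l1leD IH); rewrite ger0_norm// => H.
apply: l1le_le (eq_l1le _ H) _ => [l/=|].
  by rewrite addnS /= /euler; ring.
rewrite le_eqVlt; apply/orP; left; apply/eqP.
by rewrite -[in RHS]natr1; ring.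
Qed.

Lemma euler_path_taylor h k j : 0 <= h -> 2 * C * h <= 1 ->
  l1le (fun l => euler_path h (k + j) l - euler_path h k l -
    j%:R * h * smoluchowski K (euler_path h k) l) (36 * C ^+ 2 * (j%:R * h) ^+ 2).
Proof.
move=> h0 hC; elim: j => [|j IH].
  move=> N; rewrite addn0 big1 ?mul0r ?expr0n ?mulr0// => i _.
  by rewrite !mul0r !subr0 subrr normr0.
have G i := fin_density_subprob (euler_path_fin_density i h0 hC).
have := smol_lip K_ge0 K_sym K_le K_0 (G (k + j)%N) (G k) (euler_path_lip k j h0 hC).
move=> /(l1leM h)/(l1leD IH); rewrite ger0_norm// => H.
apply: l1le_le (eq_l1le _ H) _ => [l/=|].
  by rewrite addnS /= /euler -[j.+1%:R]natr1; ring.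
rewrite -[j.+1%:R]natr1.
have : 0 <= C ^+ 2 * h ^+ 2 by rewrite mulr_ge0 ?exprn_ge0.
have : 0 <= C ^+ 2 * h ^+ 2 * j%:R by rewrite !mulr_ge0 ?exprn_ge0.
nra.
Qed.

(** Two half steps differ from one step at second order only. *)
Lemma euler_path_halve h k : 0 <= h -> 2 * C * h <= 1 ->
  l1le (fun l => euler_path (h / 2) k.*2 l - euler_path h k l)
    (expR (6 * C * (k%:R * h)) * (9 * C ^+ 2 * (k%:R * h) * h)).
Proof.
move=> h0 hC; have h20 : 0 <= h / 2 by rewrite divr_ge0.
have hC2 : 2 * C * (h / 2) <= 1 by nra.
have G := fin_density_subprob (euler_path_fin_density _ h0 hC).
have G2 := fin_density_subprob (euler_path_fin_density _ h20 hC2).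
pose B := 9 * C ^+ 2 * h ^+ 2.
pose d := fun k : nat => iter k (fun x => (1 + 6 * C * h) * x + B) 0.
have B0 : 0 <= B by rewrite !mulr_ge0 ?exprn_ge0.
have H : l1le (fun l => euler_path (h / 2) k.*2 l - euler_path h k l) (d k).
  elim: k => [|k IH].
    by move=> N; rewrite big1// => i _; rewrite subrr normr0.
  have IH' := euler_l1 h0 (G2 _) (G k) IH.
  have := smol_lip K_ge0 K_sym K_le K_0 (G2 (k.*2 + 1)%N) (G2 k.*2)
    (euler_path_lip k.*2 1 h20 hC2).
  move=> /(l1leM (h / 2))/(l1leD IH'); rewrite ger0_norm// => H.
  apply: l1le_le (eq_l1le _ H) _ => [l/=|].
    by rewrite addn1 /= /euler; field.
  by rewrite /d /= /B -/(d k) lerD2l mul1r le_eqVlt; apply/orP; left; apply/eqP; field.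
apply: l1le_le H _.
have A0 : 0 <= 6 * C * h by rewrite !mulr_ge0.
have := @discrete_gronwall _ _ B d A0 B0 (lexx _) (fun=> lexx _) k.
move/le_trans; apply; rewrite (_ : 6 * C * h * k%:R = 6 * C * (k%:R * h)); last by ring.
by rewrite ler_wpM2l ?expR_ge0// add0r /B le_eqVlt; apply/orP; left; apply/eqP; ring.
Qed.

End euler.

(** * The limit of the dyadic Euler schemes *)

Section euler_limit.
Variables (R : realType) (K : nat -> nat -> R) (C : R).
Hypothesis K_ge0 : forall i j, 0 <= K i j.
Hypothesis K_sym : forall i j, K i j = K j i.
Hypothesis K_le : forall i j, K i j <= C.
Hypothesis K_0 : forall l, K 0%N l = 0.
Implicit Types (s t : R).
Let C0 : 0 <= C := kernel_bound_ge0 K_ge0 K_le.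

(** The first factor keeps the Euler steps in the range where they preserve
   positivity. *)
Definition mesh m : R := (2 * C + 1)^-1 * 2^-1 ^+ m.

Lemma mesh_gt0 m : 0 < mesh m.
Proof. by rewrite mulr_gt0 ?invr_gt0 ?exprn_gt0 ?invr_gt0// ltr_wpDl// mulr_ge0. Qed.

Let mesh_ge0 m : 0 <= mesh m := ltW (mesh_gt0 m).

Lemma meshS m : mesh m.+1 = mesh m / 2.
Proof. by rewrite /mesh exprSr mulrA. Qed.

Lemma mesh_small m : 2 * C * mesh m <= 1.
Proof.
have D0 : 0 < 2 * C + 1 by rewrite ltr_wpDl// mulr_ge0.
have M0 : 0 <= mesh 0 by [].
have : 2 * C * mesh 0 <= 1.
  by rewrite /mesh expr0 mulr1 ler_pdivrMr// mul1r lerDl.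
elim: m => [|m IH]// /IH; rewrite meshS; have := mesh_ge0 m.
by have := mulr_ge0 C0 (mesh_ge0 m); lra.
Qed.

Lemma mesh_cvg : mesh @ \oo --> (0 : R).
Proof.
apply: cvg_geometric; rewrite ger0_norm ?invr_ge0//.
by rewrite invf_lt1// ltr1n.
Qed.

Definition tick m t := Num.truncn (t / mesh m).

Lemma tick_itv m t : 0 <= t -> (tick m t)%:R * mesh m <= t < (tick m t)%:R * mesh m + mesh m.
Proof.
move=> t0; have := truncn_itv (divr_ge0 t0 (mesh_ge0 m)).
rewrite ler_pdivlMr ?mesh_gt0// ltr_pdivrMr ?mesh_gt0// -/(tick m t).
by rewrite -natr1 mulrDl mul1r.
Qed.

Lemma tickS m t : 0 <= t ->
  tick m.+1 t = (tick m t).*2 \/ tick m.+1 t = ((tick m t).*2 + 1)%N.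
Proof.
move=> t0; have /andP[a b] := tick_itv m t0; have /andP[c d] := tick_itv m.+1 t0.
move: a b c d; rewrite meshS; set k := tick m t; set k' := tick _ _ => a b c d.
have h0 := mesh_gt0 m.
have H1 : (k'%:R < (k.*2 + 2)%:R :> R).
  rewrite -(@ltr_pM2r _ (mesh m / 2)) ?divr_gt0// (le_lt_trans c)//.
  by rewrite natrD -mul2n natrM; lra.
have H2 : ((k.*2)%:R < k'.+1%:R :> R).
  rewrite -(@ltr_pM2r _ (mesh m / 2)) ?divr_gt0//; apply: le_lt_trans (_ : t < _).
    by rewrite -mul2n natrM; lra.
  by rewrite -natr1 mulrDl mul1r.
by move: H1 H2; rewrite !ltr_nat; lia.
Qed.

Definition approx m t : nat -> R := euler_path K (mesh m) (tick m t).

Lemma approx_subprob m t : subprob (approx m t).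
Proof.
apply: fin_density_subprob; apply: (euler_path_fin_density K_ge0 K_sym K_le K_0) => //.
exact: mesh_small.
Qed.

Definition rate t := 2 * (expR (6 * C * t) * (9 * C ^+ 2 * t) + 3 * C).

Lemma rate_ge0 t : 0 <= t -> 0 <= rate t.
Proof. by move=> t0; rewrite mulr_ge0// addr_ge0// !mulr_ge0 ?expR_ge0 ?exprn_ge0. Qed.

Lemma approxS m t : 0 <= t ->
  l1le (fun l => approx m.+1 t l - approx m t l) (rate t * mesh m.+1).
Proof.
move=> t0; have /andP[a _] := tick_itv m t0.
have h0 := mesh_ge0 m.
have A := euler_path_halve K_ge0 K_sym K_le K_0 (tick m t) h0 (mesh_small m).
have Ab : l1le (fun l => euler_path K (mesh m / 2) (tick m t).*2 l - approx m t l)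
    (expR (6 * C * t) * (9 * C ^+ 2 * t) * mesh m).
  apply: l1le_le A _; rewrite [leLHS]mulrA ler_wpM2r//.
  apply: ler_pM; first exact: expR_ge0.
  - by apply: mulr_ge0; [rewrite mulr_ge0 ?exprn_ge0|exact: mulr_ge0].
  - by rewrite ler_expR ler_wpM2l// mulr_ge0.
  - by rewrite ler_wpM2l// mulr_ge0// exprn_ge0.
suff H k : k = (tick m t).*2 \/ k = ((tick m t).*2 + 1)%N ->
    l1le (fun l => euler_path K (mesh m.+1) k l - approx m t l) (rate t * mesh m.+1).
  exact: H (tickS m t0).
have Cm : 0 <= C * mesh m by rewrite mulr_ge0.
rewrite -meshS in Ab; move=> [->|->].
  by apply: l1le_le Ab _; rewrite /rate meshS; lra.
have B := euler_path_lip K_ge0 K_sym K_le K_0 (tick m t).*2 1 (mesh_ge0 m.+1) (mesh_small _).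
by apply: l1le_le (l1le_triangle B Ab) _; rewrite /rate meshS; lra.
Qed.

Lemma approx_dist m j t : 0 <= t ->
  l1le (fun l => approx (m + j) t l - approx m t l) (rate t * (mesh m - mesh (m + j))).
Proof.
move=> t0; elim: j => [|j IH].
  by move=> N; rewrite addn0 subrr mulr0 big1// => i _; rewrite subrr normr0.
rewrite addnS; apply: l1le_le (l1le_triangle (approxS (m + j) t0) IH) _.
by rewrite -mulrDr meshS ler_wpM2l ?rate_ge0//; lra.
Qed.

(** Coordinatewise limits suffice as a definition: [approx_rate] gives
   convergence in l^1. *)
Definition flow t l : R := limn (fun m => approx m t l).

(** The increments of the sequence of schemes are summable in l^1. *)
Lemma approx_cvg t l : 0 <= t -> (fun m => approx m t l) @ \oo --> flow t l.
Proof.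
move=> t0; pose D i := approx i.+1 t l - approx i t l.
have : l1le D (rate t * mesh 0).
  move=> N; apply: le_trans (_ : \sum_(i < N) rate t * (mesh i - mesh i.+1) <= _).
    apply: ler_sum => i _; have := l1le_coord (approxS i t0) l.
    by move/le_trans; apply; rewrite meshS ler_wpM2l ?rate_ge0//; lra.
  rewrite -mulr_sumr ler_wpM2l ?rate_ge0//.
  have -> : \sum_(i < N) (mesh i - mesh i.+1) = mesh 0 - mesh N.
    elim: N => [|N IH]; first by rewrite big_ord0 subrr.
    by rewrite big_ord_recr/= IH; ring.
  by rewrite lerBlDr lerDl.
move=> /isum_cvg cD.
have E m : approx m t l = approx 0 t l + \sum_(i < m) D i.
  elim: m => [|m IH]; first by rewrite big_ord0 addr0.
  by rewrite big_ord_recr/= addrA -IH /D; ring.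
suff H : (fun m => approx m t l) @ \oo --> approx 0 t l + isum D.
  by rewrite /flow (cvg_lim _ H).
under eq_fun do rewrite E.
by apply: cvgD => //; exact: cvg_cst.
Qed.

Lemma approx_rate m t : 0 <= t ->
  l1le (fun l => flow t l - approx m t l) (rate t * mesh m).
Proof.
move=> t0.
apply: (@l1le_cvg _ (fun M l => approx M t l - approx m t l) (fun=> rate t * mesh m)).
- by move=> l; apply: cvgB; [exact: approx_cvg|exact: cvg_cst].
- exact: cvg_cst.
near=> M; have mM : (m <= M)%N by near: M; exact: nbhs_infty_ge.
rewrite -(subnKC mM); apply: l1le_le (approx_dist m (M - m) t0) _.
by rewrite ler_wpM2l ?rate_ge0// lerBlDr lerDl.
Unshelve. all: by end_near. Qed.

Lemma flow_subprob t : 0 <= t -> subprob (flow t).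
Proof.
move=> t0; split.
- apply: cvg_lim => //; apply: cvg_near_cst; near=> m.
  by case: (approx_subprob m t).
- move=> l; rewrite -(cvg_lim _ (@approx_cvg t l t0))//.
  apply: limr_ge; first by apply/cvg_ex; exists (flow t l); exact: approx_cvg.
  by near=> m; case: (approx_subprob m t).
- apply: (@l1le_cvg _ (fun m => approx m t) (fun=> 1)).
  + by move=> l; exact: approx_cvg.
  + exact: cvg_cst.
  + by near=> m; case: (approx_subprob m t).
Unshelve. all: by end_near. Qed.

Lemma flow0 : flow 0 = delta1 R.
Proof.
apply/funext => l; apply: cvg_lim => //; apply: cvg_near_cst; near=> m.
have : (tick m 0 <= 0)%N by rewrite /tick mul0r truncn0.
by rewrite leqn0 /approx => /eqP ->.
Unshelve. all: by end_near. Qed.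

Lemma smol_approx_cvg t l : 0 <= t ->
  (fun m => smoluchowski K (approx m t) l) @ \oo --> smoluchowski K (flow t) l.
Proof.
move=> t0; apply/subr_cvg0; apply: norm_cvg0.
have Z : (fun m => 6 * C * (rate t * mesh m)) @ \oo --> (0 : R).
  rewrite -(mulr0 (6 * C)) -(mulr0 (rate t)).
  by do 2 apply: cvgMl_tmp; exact: mesh_cvg.
apply: squeeze_cvgr (cvg_cst 0) Z; near=> m; rewrite normr_ge0/=.
rewrite distrC.
exact: l1le_coord (smol_lip K_ge0 K_sym K_le K_0 (flow_subprob t0)
  (approx_subprob m t) (approx_rate m t0)) l.
Unshelve. all: by end_near. Qed.

Lemma tick_cvg t : 0 <= t -> (fun m => (tick m t)%:R * mesh m) @ \oo --> t.
Proof.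
move=> t0; have Z : (fun m => t - mesh m) @ \oo --> t.
  by rewrite -[X in _ --> X]subr0; apply: cvgB; [exact: cvg_cst|exact: mesh_cvg].
apply: squeeze_cvgr Z (cvg_cst t); near=> m.
by have /andP[a b] := tick_itv m t0; rewrite a andbT lerBlDr ltW.
Unshelve. all: by end_near. Qed.

Lemma tick_le m s t : s <= t -> (tick m s <= tick m t)%N.
Proof. by move=> st; apply: le_truncn; rewrite ler_wpM2r ?invr_ge0. Qed.

Lemma flow_lip s t : 0 <= s -> s <= t ->
  l1le (fun l => flow t l - flow s l) (6 * C * (t - s)).
Proof.
move=> s0 st; have t0 := le_trans s0 st.
apply: (@l1le_cvg _ (fun m l => approx m t l - approx m s l)
  (fun m => 6 * C * ((tick m t)%:R * mesh m - (tick m s)%:R * mesh m))).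
- by move=> l; apply: cvgB; exact: approx_cvg.
- by apply: cvgMl_tmp; apply: cvgB; exact: tick_cvg.
near=> m; rewrite /approx -(subnKC (tick_le m st)).
set k := tick m s; set j := (tick m t - k)%N.
rewrite (_ : (k + j)%:R * mesh m - k%:R * mesh m = j%:R * mesh m); last first.
  by rewrite natrD; ring.
by apply: euler_path_lip => //; exact: mesh_small.
Unshelve. all: by end_near. Qed.

(** The differential equation in a form free of derivatives and integrals, which
   passes to the limit from the Euler schemes. *)
Lemma flow_taylor s t : 0 <= s -> s <= t ->
  l1le (fun l => flow t l - flow s l - (t - s) * smoluchowski K (flow s) l)
    (36 * C ^+ 2 * (t - s) ^+ 2).
Proof.
move=> s0 st; have t0 := le_trans s0 st.
have dcvg : (fun m => (tick m t)%:R * mesh m - (tick m s)%:R * mesh m) @ \oo --> t - s.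
  by apply: cvgB; exact: tick_cvg.
apply: (@l1le_cvg _ (fun m l => approx m t l - approx m s l -
    ((tick m t)%:R * mesh m - (tick m s)%:R * mesh m) * smoluchowski K (approx m s) l)
  (fun m => 36 * C ^+ 2 * ((tick m t)%:R * mesh m - (tick m s)%:R * mesh m) ^+ 2)).
- move=> l; apply: cvgB; first by apply: cvgB; exact: approx_cvg.
  by apply: cvgM => //; exact: smol_approx_cvg.
- by apply: cvgMl_tmp; rewrite expr2; under eq_fun do rewrite expr2; exact: cvgM.
near=> m; rewrite /approx -(subnKC (tick_le m st)).
set k := tick m s; set j := (tick m t - k)%N.
rewrite (_ : (k + j)%:R * mesh m - k%:R * mesh m = j%:R * mesh m); last first.
  by rewrite natrD; ring.
by apply: euler_path_taylor => //; exact: mesh_small.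
Unshelve. all: by end_near. Qed.

(** Consistency is [flow_taylor], stability is [euler_l1]. *)
Lemma euler_path_flow h k : 0 <= h -> 2 * C * h <= 1 ->
  l1le (fun l => euler_path K h k l - flow (k%:R * h) l)
    (expR (6 * C * (k%:R * h)) * (36 * C ^+ 2 * (k%:R * h) * h)).
Proof.
move=> h0 hC.
have G i := fin_density_subprob (euler_path_fin_density K_ge0 K_sym K_le K_0 i h0 hC).
pose B := 36 * C ^+ 2 * h ^+ 2.
pose d := fun k : nat => iter k (fun x => (1 + 6 * C * h) * x + B) 0.
have B0 : 0 <= B by rewrite !mulr_ge0 ?exprn_ge0.
have H : l1le (fun l => euler_path K h k l - flow (k%:R * h) l) (d k).
  elim: k => [|k IH].
    by move=> N; rewrite mul0r flow0 big1// => i _; rewrite subrr normr0.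
  have kh0 : 0 <= k%:R * h by rewrite mulr_ge0.
  have IH' := euler_l1 K_ge0 K_sym K_le K_0 h0 (G _) (flow_subprob kh0) IH.
  have le1 : k%:R * h <= k.+1%:R * h by rewrite ler_wpM2r// ler_nat.
  have := l1leB IH' (flow_taylor kh0 le1).
  rewrite (_ : k.+1%:R * h - k%:R * h = h); last by rewrite -natr1; ring.
  move=> H; apply: eq_l1le H => l /=; rewrite /euler; ring.
apply: l1le_le H _.
have A0 : 0 <= 6 * C * h by rewrite !mulr_ge0.
have := @discrete_gronwall _ _ B d A0 B0 (lexx _) (fun=> lexx _) k.
move/le_trans; apply; rewrite (_ : 6 * C * h * k%:R = 6 * C * (k%:R * h)); last by ring.
by rewrite ler_wpM2l ?expR_ge0// add0r /B le_eqVlt; apply/orP; left; apply/eqP; ring.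
Qed.

End euler_limit.

(** * Derivatives and limits from quantitative bounds *)

Section calculus.
Variable R : realType.

Lemma is_derive_quadratic (g : R -> R) (x d c : R) :
  (\forall s \near x, `|g s - g x - (s - x) * d| <= c * (s - x) ^+ 2) ->
  is_derive x 1 g d.
Proof.
move=> H.
have cv : h^-1 *: ((g \o shift x) (h *: 1) - g x) @[h --> 0^'] --> d.
  apply/cvgrPdist_le => e e0.
  have H' : \forall h \near (0:R)^', `|g (h + x) - g x - (h + x - x) * d| <= c * (h + x - x) ^+ 2.
    apply: nbhs_dnbhs.
    have cs : h + x @[h --> (0 : R)] --> x.
      by rewrite -[X in _ --> X]add0r; apply: cvgD; [exact: cvg_id|exact: cvg_cst].
    exact: cs _ H.
  have e1 : 0 < e / (`|c| + 1) by rewrite divr_gt0// ltr_wpDl.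
  have N0 : \forall h \near (0:R)^', `|h| <= e / (`|c| + 1).
    apply: nbhs_dnbhs; near=> h.
    have : ball 0 (e / (`|c| + 1)) h by near: h; exact: nbhsx_ballx.
    by rewrite /ball/= sub0r normrN => /ltW.
  near=> h.
  have hn0 : h != 0 by near: h; exact: nbhs_dnbhs_neq.
  have : `|g (h + x) - g x - (h + x - x) * d| <= c * (h + x - x) ^+ 2 by near: h.
  have : `|h| <= e / (`|c| + 1) by near: h.
  rewrite addrK ler_pdivlMr ?ltr_wpDl// => he hg.
  rewrite /= [_ *: 1]mulr1.
  rewrite (_ : _ - _ = - (h^-1 * (g (h + x) - g x - h * d))); last first.
    by rewrite /GRing.scale/=; field.
  rewrite normrN normrM normfV ler_pdivrMl ?normr_gt0//.
  apply: le_trans hg _.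
  apply: le_trans (_ : `|c| * `|h| ^+ 2 <= _).
    by rewrite -normrX -normrM ler_norm.
  rewrite expr2 mulrCA ler_wpM2l//; apply: le_trans he.
  by rewrite mulrDr mulr1 mulrC lerDl.
apply: DeriveDef; first by apply/cvg_ex; exists d.
exact: cvg_lim cv.
Unshelve. all: by end_near. Qed.

Lemma lip_continuous_within (E : metricType R) (T c : R) (f : R -> E) :
  {in `[0, T] &, forall s t, mdist (f s) (f t) <= c * `|s - t|} ->
  {within `[0, T], continuous f}.
Proof.
move=> H; apply/subspace_continuousP => x xT.
apply/cvg_ballP => e e0; rewrite ballEmdist.
have e1 : 0 < e / (`|c| + 1) by rewrite divr_gt0// ltr_wpDl.
rewrite near_withinE; near=> s => sT /=.
apply: le_lt_trans (H _ _ _ _) _; rewrite ?inE//.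
have : ball x (e / (`|c| + 1)) s by near: s; exact: nbhsx_ballx.
rewrite /ball/= ltr_pdivlMr ?ltr_wpDl// mulrC; apply: le_lt_trans.
by rewrite ler_wpM2r// ler_wpDr// ler_norm.
Unshelve. all: by end_near. Qed.

Lemma lip_continuous (E : metricType R) (c : R) (f : E -> R) :
  (forall x y, `|f x - f y| <= c * mdist x y) -> continuous f.
Proof.
move=> H x; apply/cvgrPdist_lt => e e0.
have e1 : 0 < e / (`|c| + 1) by rewrite divr_gt0// ltr_wpDl.
near=> y; apply: le_lt_trans (H _ _) _.
have : ball x (e / (`|c| + 1)) y by near: y; exact: nbhsx_ballx.
rewrite ballEmdist/= ltr_pdivlMr ?ltr_wpDl// mulrC; apply: le_lt_trans.
by rewrite ler_wpM2r ?mdist_ge0// ler_wpDr// ler_norm.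
Unshelve. all: by end_near. Qed.

Lemma near_harmonic_lt (c e : R) : 0 < e ->
  \forall m \near \oo, c * m.+1%:R^-1 < e.
Proof.
move=> e0; have cv : (fun m => c * harmonic m) @ \oo --> (0 : R).
  by rewrite -(mulr0 c); apply: cvgMl_tmp; exact: cvg_harmonic.
exact: cvgr_lt cv _ e0.
Qed.

Lemma le_of_harmonic (x y c : R) :
  (\forall m \near \oo, x <= y + c * m.+1%:R^-1) -> x <= y.
Proof.
move=> H.
have cv : (fun m => y + c * harmonic m) @ \oo --> y.
  rewrite -[X in _ --> X]addr0 -(mulr0 c); apply: cvgD; first exact: cvg_cst.
  by apply: cvgMl_tmp; exact: cvg_harmonic.
exact: ler_cvg_to (cvg_cst x) cv H.
Unshelve. all: by end_near. Qed.

End calculus.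

(** * Existence and uniqueness of weak solutions *)

Section weak_solutions.
Variables (R : realType) (K : nat -> nat -> R) (C : R).
Hypothesis K_ge0 : forall i j, 0 <= K i j.
Hypothesis K_sym : forall i j, K i j = K j i.
Hypothesis K_le : forall i j, K i j <= C.
Hypothesis K_0 : forall l, K 0%N l = 0.
Implicit Types (s t : R).
Let C0 : 0 <= C := kernel_bound_ge0 K_ge0 K_le.

Lemma mdistE (u v : Mplus R) : mdist u v = l1dist u v.
Proof. by []. Qed.

Lemma smol_coord_lip (u v : Mplus R) l :
  `|smoluchowski K u l - smoluchowski K v l| <= 6 * C * mdist u v.
Proof.
exact: l1le_coord (smol_lip K_ge0 K_sym K_le K_0 (Mplus_subprob u)
  (Mplus_subprob v) (l1le_l1dist u v)) l.
Qed.

Definition solution t : Mplus R :=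
  match @idP (0 <= t) with
  | ReflectT h => Mplus_of (flow_subprob K_ge0 K_sym K_le K_0 h)
  | ReflectF _ => delta1 R
  end.

Lemma solutionE t : 0 <= t -> solution t = flow K C t :> (nat -> R).
Proof. by rewrite /solution; case: {-}_ / idP. Qed.

Lemma solution_lip s t : 0 <= s -> 0 <= t -> l1dist (solution s) (solution t) <= 6 * C * `|s - t|.
Proof.
wlog ts : s t / t <= s => [H s0 t0|s0 t0].
  have [|/ltW st] := leP t s; first by move/H; exact.
  by rewrite l1dist_sym distrC H.
apply/l1dist_leP; rewrite !solutionE// ger0_norm ?subr_ge0//.
exact: flow_lip.
Qed.

Lemma solution_taylor s t : 0 <= s -> s <= t ->
  l1le (fun l => solution t l - solution s l - (t - s) * smoluchowski K (solution s) l)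
    (36 * C ^+ 2 * (t - s) ^+ 2).
Proof.
move=> s0 st; rewrite (solutionE s0) (solutionE (le_trans s0 st)).
exact: flow_taylor.
Qed.

Lemma solution_derive t l : 0 < t ->
  is_derive t 1 (fun s => solution s l) (smoluchowski K (solution t) l).
Proof.
move=> t0; apply: (@is_derive_quadratic _ _ _ _ (72 * C ^+ 2)).
have C2 : 0 <= C ^+ 2 by rewrite exprn_ge0.
near=> s; have s0 : 0 <= s by apply/ltW; near: s; exact: lt_nbhsr.
have [ts|/ltW st] := leP t s.
  have := l1le_coord (solution_taylor (ltW t0) ts) l.
  by move/le_trans; apply; rewrite ler_wpM2r ?sqr_ge0//; lra.
have := l1le_coord (solution_taylor s0 st) l.
have := smol_coord_lip (solution s) (solution t) l.
have := solution_lip s0 (ltW t0).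
rewrite mdistE distrC ger0_norm ?subr_ge0// => H1 H2 H3.
rewrite (_ : _ - _ = - (solution t l - solution s l - (t - s) * smoluchowski K (solution s) l)
  - (t - s) * (smoluchowski K (solution s) l - smoluchowski K (solution t) l)); last by ring.
apply: le_trans (ler_normB _ _) _; rewrite normrN normrM.
rewrite (_ : 72 * C ^+ 2 * (s - t) ^+ 2 = 36 * C ^+ 2 * (t - s) ^+ 2 +
  (t - s) * (6 * C * (6 * C * (t - s)))); last by ring.
apply: lerD => //; rewrite ger0_norm ?subr_ge0// ler_wpM2l ?subr_ge0//.
by apply: le_trans H2 _; rewrite ler_wpM2l// mulr_ge0.
Unshelve. all: by end_near. Qed.

Lemma solution_weak T : weak_solution K T (delta1 R) solution.
Proof.
have S0 : solution 0 = delta1 R by apply: Mplus_eqP => l; rewrite solutionE// flow0.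
have cts t : {within `[0, t], continuous solution}.
  apply: (@lip_continuous_within _ _ _ (6 * C)) => r s.
  by rewrite !in_itv/= => /andP[r0 _] /andP[s0 _]; exact: solution_lip.
split=> // t; rewrite in_itv/= => /andP[t0 tT] l l1.
have [->|tn0] := eqVneq t 0; first by rewrite set_itv1 Rintegral_set1 addr0.
have {}t0 : 0 < t by rewrite lt_neqAle eq_sym tn0.
rewrite /Rintegral.
rewrite (@continuous_FTC2 R (fun s => smoluchowski K (solution s) l) (fun s => solution s l))//.
- by rewrite -EFinB/=; ring.
- apply: (@within_continuous_comp _ _ _ _ solution (fun u : Mplus R => smoluchowski K u l)) => //.
  by move=> u _; apply: (@lip_continuous _ _ (6 * C)) => v w; exact: smol_coord_lip.
- have : {within `[0, t], continuous (fun s => solution s l)}.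
    apply: (@within_continuous_comp _ _ _ _ solution (fun u : Mplus R => u l)) => //.
    move=> u _; apply: (@lip_continuous _ _ 1) => v w.
    by rewrite mul1r; exact: l1le_coord (l1le_l1dist v w) l.
  move=> /continuous_within_itvP-/(_ t0)[_ H1 H2]; split => // s.
  by rewrite in_itv/= => /andP[s0 _]; case: (solution_derive l s0).
- by move=> s; rewrite in_itv/= => /andP[s0 _]; rewrite derive1E; case: (solution_derive l s0).
Qed.

(** The mean value theorem, applied to finite sums of coordinates with the signs
   of the quantity to be bounded as coefficients, estimates l^1 norms from the
   scalar equations. *)
Lemma weak_taylor T v : weak_solution K T (delta1 R) v ->
  forall s t, 0 <= s -> s <= t -> t <= T ->
  l1le (fun l => v t l - v s l - (t - s) * smoluchowski K (v s) l)
    (36 * C ^+ 2 * (t - s) ^+ 2).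
Proof.
move=> [vc v0 vE].
have smolc l : {within `[0, T], continuous (fun s => smoluchowski K (v s) l)}.
  apply: (@within_continuous_comp _ _ _ _ v (fun u : Mplus R => smoluchowski K u l)) => //.
  by move=> u _; apply: (@lip_continuous _ _ (6 * C)) => x y; exact: smol_coord_lip.
have vd x l : 0 < x < T -> is_derive x 1 (fun s => v s l) (smoluchowski K (v x) l).
  move=> /andP[x0 xT]; case: l => [|l].
    rewrite (_ : smoluchowski K (v x) 0 = 0).
      by apply: (@near_eq_is_derive _ _ _ (fun=> 0)); near=> y; rewrite density0.
    have [z0 _ b1] := Mplus_subprob (v x).
    by rewrite (smolE K_ge0 K_sym K_le K_0 _ b1) big_ord1 z0; ring.
  have int : lebesgue_measure.-integrable `[0, T]
      (EFin \o (fun s => smoluchowski K (v s) l.+1)).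
    by apply: continuous_compact_integrable => //; exact: segment_compact.
  have cx : {for x, continuous (fun s => smoluchowski K (v s) l.+1)}.
    apply: (within_continuous_continuous (lt_trans x0 xT) (smolc l.+1)).
    by rewrite in_itv/= x0 xT.
  have [d1 d2] := continuous_FTC1_closed xT int x0 cx.
  have D : is_derive x 1 (fun y => v 0 l.+1 +
      \int[lebesgue_measure]_(s in `[0, y]) smoluchowski K (v s) l.+1)
      (smoluchowski K (v x) l.+1).
    rewrite -[X in is_derive _ _ _ X]add0r; apply: is_deriveD.
    by apply: DeriveDef => //; rewrite -derive1E.
  apply: near_eq_is_derive D; near=> y.
  rewrite -vE// in_itv/=; apply/andP; split; apply/ltW; near: y.
    exact: lt_nbhsr.
  exact: lt_nbhsl.
have mvt s t N (eps : nat -> R) : 0 <= s -> s < t -> t <= T ->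
    exists2 x, s < x < t & \sum_(l < N) eps l * (v t l - v s l) =
      (t - s) * \sum_(l < N) eps l * smoluchowski K (v x) l.
  move=> s0 st tT; pose g := \sum_(l < N) (eps l \*: (fun y => v y l)) : R -> R.
  have gE y : g y = \sum_(l < N) eps l * v y l by rewrite /g fct_sumE.
  have [||x xst gx] := @MVT R g (fun x => \sum_(l < N) eps l * smoluchowski K (v x) l) _ _ st.
  - move=> x; rewrite in_itv/= => /andP[sx xt].
    apply: is_derive_sum => i; apply: is_deriveZ; apply: vd.
    by rewrite (le_lt_trans s0 sx) (lt_le_trans xt tT).
  - have : {within `[0, T], continuous g}.
      rewrite (_ : g = (fun u : Mplus R => \sum_(l < N) eps l * u l) \o v); last first.
        by apply/funext => y; rewrite gE.
      apply: within_continuous_comp => // u _.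
      apply: (@lip_continuous _ _ (\sum_(l < N) `|eps l|)) => x y.
      rewrite -sumrB mulr_suml; apply: le_trans (ler_norm_sum _ _ _) _.
      apply: ler_sum => i _; rewrite -mulrBr normrM ler_wpM2l//.
      exact: l1le_coord (l1le_l1dist x y) i.
    apply: continuous_subspaceW => y /=; rewrite !in_itv/= => /andP[a b].
    by rewrite (le_trans s0 a) (le_trans b tT).
  - exists x => //.
    by rewrite mulrC -gx !gE -sumrB; apply: eq_bigr => i _; rewrite mulrBr.
have sgle (x : R) (y : R) : Num.sg x * y <= `|y|.
  apply: le_trans (ler_norm _) _; rewrite normrM normr_sg.
  by rewrite ler_piMl// lern1 leq_b1.
have lip r t : 0 <= r -> r < t -> t <= T -> l1le (fun l => v t l - v r l) (6 * C * (t - r)).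
  move=> r0 rt tT N; have [x _ E] := mvt r t N (fun l => Num.sg (v t l - v r l)) r0 rt tT.
  under eq_bigr do rewrite normrEsg.
  rewrite E mulrC ler_wpM2r ?subr_ge0 ?(ltW rt)//.
  apply: le_trans (smol_bound K_ge0 K_sym K_le K_0 (Mplus_subprob (v x)) N).
  by apply: ler_sum => i _; exact: sgle.
move=> s t s0 st tT; have [->|snt] := eqVneq s t.
  by move=> N; rewrite subrr expr0n mulr0 big1// => i _; rewrite mul0r subr0 subrr normr0.
have {}st : s < t by rewrite lt_neqAle snt.
have ts0 : 0 <= t - s by rewrite subr_ge0 ltW.
move=> N; set r := fun l => v t l - v s l - (t - s) * smoluchowski K (v s) l.
have [x /andP[sx xt] E] := mvt s t N (fun l => Num.sg (r l)) s0 st tT.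
rewrite (eq_bigr (fun l : 'I_N => Num.sg (r l) * (v t l - v s l) -
  (t - s) * (Num.sg (r l) * smoluchowski K (v s) l))); last first.
  by move=> l _; rewrite normrEsg {2}/r; ring.
rewrite sumrB E -mulr_sumr -mulrBr -sumrB.
rewrite [leRHS](_ : _ = (t - s) * (36 * C ^+ 2 * (t - s))); last by ring.
rewrite ler_wpM2l//.
have H := smol_lip K_ge0 K_sym K_le K_0 (Mplus_subprob (v x)) (Mplus_subprob (v s))
  (lip s x s0 sx (le_trans (ltW xt) tT)).
apply: le_trans (_ : 6 * C * (6 * C * (x - s)) <= _).
  apply: le_trans (H N); apply: ler_sum => i _.
  by rewrite -mulrBr; exact: sgle.
rewrite mulrA (_ : 6 * C * (6 * C) = 36 * C ^+ 2); last by ring.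
by rewrite ler_wpM2l ?mulr_ge0 ?exprn_ge0// lerD2r ltW.
Unshelve. all: by end_near. Qed.

(** Along a grid of step h, two paths with the same Taylor expansion separate by
   at most a multiple of h. *)
Lemma weak_unique T v t : weak_solution K T (delta1 R) v -> t \in `[0, T] ->
  v t = solution t.
Proof.
move=> vw; rewrite in_itv/= => /andP[t0 tT]; have [_ v0 _] := vw.
apply: Mplus_eqP => l; apply/eqP; rewrite -subr_eq0 -normr_le0.
apply: (@le_of_harmonic _ _ _ (expR (6 * C * t) * (72 * C ^+ 2 * t ^+ 2))).
apply: nearW => m.
pose h := t / m.+1%:R; have h0 : 0 <= h by rewrite divr_ge0.
have hm : m.+1%:R * h = t by rewrite /h mulrC divfK.
pose B := 72 * C ^+ 2 * h ^+ 2.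
pose d := fun k : nat => iter k (fun x => (1 + 6 * C * h) * x + B) 0.
have B0 : 0 <= B by rewrite !mulr_ge0 ?exprn_ge0.
have H k : (k <= m.+1)%N -> l1le (fun l => v (k%:R * h) l - solution (k%:R * h) l) (d k).
  elim: k => [_|k IH km].
    by move=> N; rewrite mul0r v0 big1// => i _; rewrite solutionE// flow0 subrr normr0.
  have kh0 : 0 <= k%:R * h by rewrite mulr_ge0.
  have le1 : k%:R * h <= k.+1%:R * h by rewrite ler_wpM2r// ler_nat.
  have le2 : k.+1%:R * h <= T by apply: le_trans tT; rewrite -hm ler_wpM2r// ler_nat.
  have {}IH := IH (ltnW km).
  have := l1leB (weak_taylor vw kh0 le1 le2) (solution_taylor kh0 le1).
  rewrite (_ : k.+1%:R * h - k%:R * h = h); last by rewrite -natr1; ring.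
  have S := smol_lip K_ge0 K_sym K_le K_0 (Mplus_subprob _) (Mplus_subprob _) IH.
  have {}S := l1leD IH (l1leM h S); move=> /(l1leD S); rewrite ger0_norm//.
  move=> H; apply: l1le_le (eq_l1le _ H) _ => [i /=|]; first by ring.
  by rewrite /d /= -/(d k) le_eqVlt; apply/orP; left; apply/eqP; rewrite /B; ring.
have := l1le_coord (H m.+1 (leqnn _)) l; rewrite hm add0r => /le_trans; apply.
have A0 : 0 <= 6 * C * h by rewrite !mulr_ge0.
have := @discrete_gronwall _ _ B d A0 B0 (lexx _) (fun=> lexx _) m.+1.
rewrite -mulrA [h * _]mulrC hm add0r => /le_trans; apply.
rewrite /B /h le_eqVlt; apply/orP; left; apply/eqP; field.
by rewrite nat1r pnatr_eq0.
Qed.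

End weak_solutions.

(** * The weighted l^2 norm *)

Section weighted_l2.
Variables (R : realType).

Lemma sum_inv_sqr_le2 N : \sum_(j < N) (j%:R ^+ 2)^-1 <= 2 :> R.
Proof.
suff H : \sum_(j < N.+2) (j%:R ^+ 2)^-1 <= 2 - (N.+1%:R)^-1 :> R.
  apply: le_trans (_ : \sum_(j < N.+2) (j%:R ^+ 2)^-1 <= _).
    apply: (ler_sum_ord_widen (F := fun j => (j%:R ^+ 2)^-1)) => [i|].
      by rewrite invr_ge0 exprn_ge0.
    by rewrite -addn2 leq_addr.
  by apply: le_trans H _; rewrite lerBlDr lerDl invr_ge0.
elim: N => [|N IH].
  by rewrite !big_ord_recr big_ord0/= expr0n/= invr0 expr1n !invr1; lra.
rewrite big_ord_recr/=; apply: le_trans (lerD IH (lexx _)) _.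
set x : R := N.+1%:R; have -> : N.+2%:R = x + 1 :> R by rewrite /x [RHS]natr1.
have x0 : 0 < x by rewrite ltr0n.
have x10 : 0 < x + 1 by rewrite addr_gt0.
rewrite -subr_ge0 (_ : _ - _ = (x * (x + 1) ^+ 2)^-1).
  by rewrite invr_ge0 mulr_ge0 ?exprn_ge0 ?ltW.
by field; rewrite !gt_eqF.
Qed.

(** By the arithmetic-geometric mean, the weights l^2 being inversely summable. *)
Lemma l1_of_l2 (v : nat -> R) (lam V : R) N : v 0%N = 0 -> 0 < lam ->
  \sum_(l < N) l%:R ^+ 2 * v l ^+ 2 <= V ->
  \sum_(l < N) `|v l| <= lam + V / (2 * lam).
Proof.
move=> v0 l0 HV.
apply: le_trans (_ : \sum_(l < N) ((lam / 2) * (l%:R ^+ 2)^-1 +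
    (2 * lam)^-1 * (l%:R ^+ 2 * v l ^+ 2)) <= _).
  apply: ler_sum => -[[|l] lN] _ /=; first by rewrite v0 normr0 expr0n/= invr0 !mul0r !mulr0 addr0.
  rewrite -[v l.+1 ^+ 2]real_normK ?num_real//.
  set a := l.+1%:R; set b := `|_|; have a0 : 0 < a by rewrite ltr0n.
  rewrite -subr_ge0 (_ : _ - _ = (lam - a ^+ 2 * b) ^+ 2 / (2 * lam * a ^+ 2)).
    by rewrite divr_ge0 ?sqr_ge0// !mulr_ge0 ?exprn_ge0 ?ltW.
  by field; rewrite !gt_eqF.
rewrite big_split/= -!mulr_sumr; apply: lerD.
  have := sum_inv_sqr_le2 N; set S := \sum_(_ < _) _ => S2; nra.
by rewrite mulrC ler_wpM2r// invr_ge0 mulr_ge0// ltW.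
Qed.

(** The contribution of one pair of sizes (a, b) to [smol_one_sided_lip]. The
   factor [a] on the right is affordable because it will be summed against a
   density with bounded first moment. As a/b + 1 <= 2a, the square terms absorb
   the cross terms. *)
Lemma pair_ineq (a b x y z : R) : 1 <= a -> 1 <= b ->
  y * ((a + b) ^+ 2 * z - a ^+ 2 * x - b ^+ 2 * y) <=
  a * ((a + b) ^+ 2 * z ^+ 2 + 5 / 2 * (b ^+ 2 * y ^+ 2) +
    a ^+ 2 * x ^+ 2 / 2 * (b ^+ 2)^-1).
Proof.
move=> a1 b1; have b0 : 0 < b by rewrite (lt_le_trans _ b1).
pose p := (a + b) * z; pose q := b * y; pose r := a * x / b; pose c := a / b + 1.
have c2a : c <= 2 * a.
  by rewrite (_ : 2 * a = a + a) ?lerD// ?ler_pdivrMr ?ler_peMr//; lra.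
have key : c * (p * q) <= a * (p ^+ 2 + q ^+ 2).
  apply: le_trans (_ : c / 2 * (p ^+ 2 + q ^+ 2) <= _).
    rewrite -subr_ge0 (_ : _ - _ = c / 2 * (p - q) ^+ 2); last by field.
    by rewrite mulr_ge0 ?sqr_ge0// divr_ge0// addr_ge0// divr_ge0//; lra.
  by rewrite ler_wpM2r ?addr_ge0 ?sqr_ge0//; lra.
rewrite -subr_ge0 (_ : _ - _ = a * (p ^+ 2 + q ^+ 2) - c * (p * q) +
  a * q ^+ 2 + q ^+ 2 + a / 2 * (r + q) ^+ 2).
  have a0 : 0 <= a by lra.
  have h1 : 0 <= a * q ^+ 2 by rewrite mulr_ge0 ?sqr_ge0.
  have h2 : 0 <= a / 2 * (r + q) ^+ 2 by rewrite mulr_ge0 ?sqr_ge0// divr_ge0.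
  have h3 : 0 <= q ^+ 2 by rewrite sqr_ge0.
  lra.
by rewrite /p /q /r /c; field; rewrite gt_eqF.
Qed.

End weighted_l2.

(** * One-sided Lipschitz bound in the weighted l^2 norm *)

Section dissipativity.
Variables (R : realType) (K : nat -> nat -> R) (C : R).
Hypothesis K_ge0 : forall i j, 0 <= K i j.
Hypothesis K_sym : forall i j, K i j = K j i.
Hypothesis K_le : forall i j, K i j <= C.
Hypothesis K_0 : forall l, K 0%N l = 0.
Let C0 : 0 <= C := kernel_bound_ge0 K_ge0 K_le.

(** The increment of the operator is bilinear in [f + g] and [f - g], so
   [pair_ineq] applies with the sizes weighted by [f + g], whose first moment is
   at most 2. The three terms of [pair_ineq] sum to 1 + 5/2 + 1 times the squared
   norm, the last one because the inverse squares sum to at most 2. *)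
Lemma smol_one_sided_lip (f g : nat -> R) N M : fin_density f -> fin_density g ->
  (forall i, (N <= i)%N -> f i = 0) -> (forall i, (N <= i)%N -> g i = 0) ->
  (N + N <= M)%N ->
  \sum_(l < M) l%:R ^+ 2 * (f l - g l) * (smoluchowski K f l - smoluchowski K g l)
  <= 9 * C * \sum_(l < M) l%:R ^+ 2 * (f l - g l) ^+ 2.
Proof.
move=> [f0 fp _ f1] [g0 gp _ g1] fN gN NM.
pose v l := f l - g l; pose s l := f l + g l.
pose phi l := l%:R ^+ 2 * v l.
pose D i j := phi (i + j)%N - phi i - phi j.
pose V := \sum_(l < M) l%:R ^+ 2 * v l ^+ 2.
have Vt0 (l : nat) : 0 <= l%:R ^+ 2 * v l ^+ 2 by rewrite mulr_ge0 ?sqr_ge0.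
have E1 : \sum_(l < M) l%:R ^+ 2 * (f l - g l) * (smoluchowski K f l - smoluchowski K g l)
    = \sum_(i < N) \sum_(j < N) K i j * s i * v j * D i j.
  under eq_bigr do rewrite mulrBr.
  rewrite sumrB (smol_weak K_ge0 K_sym K_le K_0 phi fN NM).
  rewrite (smol_weak K_ge0 K_sym K_le K_0 phi gN NM).
  rewrite -sumrB (eq_bigr (fun i : 'I_N => \sum_(j < N) K i j * f i * v j * D i j +
      \sum_(j < N) K i j * v i * g j * D i j)); last first.
    move=> i _; rewrite -sumrB -big_split/=; apply: eq_bigr => j _.
    by rewrite /v /D; ring.
  rewrite big_split/= [X in _ + X]exchange_big/= -big_split/=; apply: eq_bigr => i _.
  rewrite -big_split/=; apply: eq_bigr => j _.
  by rewrite K_sym /s /D addnC; ring.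
rewrite E1 -/V.
have s0 i : 0 <= s i by rewrite addr_ge0.
have term (i j : nat) : K i j * s i * v j * D i j <= C * (i%:R * s i) *
    ((i + j)%:R ^+ 2 * v (i + j)%N ^+ 2 + 5 / 2 * (j%:R ^+ 2 * v j ^+ 2) +
     (i%:R ^+ 2 * v i ^+ 2) / 2 * (j%:R ^+ 2)^-1).
  set Bd := (X in _ <= _ * X).
  have B0 : 0 <= Bd.
    by rewrite !addr_ge0// mulr_ge0// ?divr_ge0// invr_ge0 sqr_ge0.
  have aB : 0 <= C * (i%:R * s i) * Bd by rewrite mulr_ge0// mulr_ge0// mulr_ge0.
  have Kz : K i j = 0 -> K i j * s i * v j * D i j <= C * (i%:R * s i) * Bd.
    by move=> ->; rewrite !mul0r.
  case: i j @Bd B0 aB Kz => [|i] [|j] Bd B0 aB Kz;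
    try by apply: Kz; rewrite ?K_0// K_sym K_0.
  rewrite [leLHS](_ : _ = K i.+1 j.+1 * (s i.+1 * (v j.+1 * D i.+1 j.+1))); last by ring.
  rewrite [leRHS](_ : _ = C * (s i.+1 * (i.+1%:R * Bd))); last by ring.
  apply: le_trans (_ : K i.+1 j.+1 * (s i.+1 * (i.+1%:R * Bd)) <= _); last first.
    by rewrite ler_wpM2r// mulr_ge0// mulr_ge0.
  rewrite ler_wpM2l// ler_wpM2l// /D /phi /Bd natrD.
  set a : R := i.+1%:R; set b : R := j.+1%:R.
  have a1 : 1 <= a by rewrite ler1n.
  have b1 : 1 <= b by rewrite ler1n.
  move: (v (i.+1 + j.+1)%N) (v i.+1) (v j.+1) => z x y.
  have b0 : b != 0 by rewrite gt_eqF// (lt_le_trans _ b1).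
  exact: pair_ineq.
apply: le_trans (_ : \sum_(i < N) C * (i%:R * s i) * (9 / 2 * V) <= _).
  apply: ler_sum => i _.
  apply: le_trans (ler_sum _ _) _; first by move=> j _; exact: term.
  rewrite -mulr_sumr ler_wpM2l//; first by rewrite !mulr_ge0.
  rewrite !big_split/= -!mulr_sumr.
  have iN := ltn_ord i.
  have P1 : \sum_(j < N) (i + j)%:R ^+ 2 * v (i + j)%N ^+ 2 <= V.
    rewrite /V -(subnKC (_ : i + N <= M)%N); last by lia.
    rewrite big_split_ord/= big_split_ord/= -addrA addrCA lerDl.
    by rewrite addr_ge0// sumr_ge0.
  have P2 : \sum_(j < N) j%:R ^+ 2 * v j ^+ 2 <= V.
    by apply: (ler_sum_ord_widen (F := fun j => j%:R ^+ 2 * v j ^+ 2)) => //; lia.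
  have P3 : i%:R ^+ 2 * v i ^+ 2 <= V.
    have iM : (i < M)%N by lia.
    by rewrite /V (bigD1 (Ordinal iM))//= lerDl sumr_ge0.
  have P4 := @sum_inv_sqr_le2 R N.
  have P5 : 0 <= \sum_(j < N) (j%:R ^+ 2)^-1 :> R.
    by rewrite sumr_ge0// => j _; rewrite invr_ge0 exprn_ge0.
  have P6 := Vt0 i.
  nra.
rewrite -mulr_suml -mulr_sumr.
have V0 : 0 <= V by rewrite sumr_ge0.
have S2 : \sum_(i < N) i%:R * s i <= 2.
  rewrite (eq_bigr (fun i : 'I_N => i%:R * f i + i%:R * g i)); last first.
    by move=> i _; rewrite mulrDr.
  rewrite big_split/= (_ : 2 = 1 + 1)//; apply: lerD.
    exact: l1le_sum N f1.
  exact: l1le_sum N g1.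
rewrite [leRHS](_ : _ = C * 2 * (9 / 2 * V)); last by field.
by rewrite ler_wpM2r ?ler_wpM2l// mulr_ge0// divr_ge0.
Qed.

End dissipativity.

(** * Empirical densities and coalescence *)

Section configurations.
Variables (R : realType) (n : nat).
Hypothesis n_gt0 : (0 < n)%N.
Implicit Types (z : config n) (x y : 'I_n).

Let n0 : 0 < n%:R :> R. Proof. by rewrite ltr0n. Qed.
Let ni0 : 0 <= n%:R^-1 :> R. Proof. by rewrite invr_ge0 ltW. Qed.

Definition mass z : nat := \sum_(x < n) z x.

Lemma le_mass z x : (z x <= mass z)%N.
Proof. by rewrite /mass (bigD1 x)//= leq_addr. Qed.

(** The value 0 is excluded, as in [empirical_fun]. *)
Definition size_ind (l i : nat) : R := ((0 < l)%N && (i == l))%:R.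

Lemma size_ind0 l : size_ind l 0 = 0.
Proof. by case: l. Qed.

Lemma empiricalE z l : empirical_fun R z l = n%:R^-1 * \sum_(x < n) size_ind l (z x).
Proof.
rewrite /empirical_fun /size_ind; case: l => [|l] /=.
  by rewrite big1 ?mulr0// => x _.
rewrite mulrC; congr (_ * _); rewrite -sum1_card big_mkcond/= natr_sum.
by apply: eq_bigr => x _; rewrite inE; case: eqP.
Qed.

Lemma sum_size_ind (phi : nat -> R) N i : phi 0%N = 0 -> (i < N)%N ->
  \sum_(l < N) phi l * size_ind l i = phi i.
Proof.
move=> p0 iN; rewrite (bigD1 (Ordinal iN))//= big1 ?addr0.
  by rewrite /size_ind eqxx andbT; case: i iN => [|i] _; rewrite ?p0 ?mul0r ?mulr1.
move=> l /eqP li; rewrite /size_ind; case: eqP => [il|_]; rewrite ?andbF ?mulr0//.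
by case: li; apply/val_inj.
Qed.

Lemma empirical_sum (phi : nat -> R) z N : phi 0%N = 0 -> (forall x, (z x < N)%N) ->
  \sum_(l < N) phi l * empirical_fun R z l = n%:R^-1 * \sum_(x < n) phi (z x).
Proof.
move=> p0 zN; under eq_bigr do rewrite empiricalE mulrCA mulr_sumr.
rewrite -mulr_sumr exchange_big/=; congr (_ * _); apply: eq_bigr => x _.
exact: sum_size_ind.
Qed.

Lemma empirical_fin_density z : mass z = n -> fin_density (empirical_fun R z).
Proof.
move=> zn; split.
- by rewrite /empirical_fun.
- exact: empirical_ge0.
- exists n.+1 => i ni; rewrite empiricalE big1 ?mulr0// => x _; rewrite /size_ind.
  case: eqP => [zx|]; rewrite ?andbF//.
  by have := le_mass z x; rewrite zn zx; lia.
- move=> N; apply: le_trans (_ : \sum_(l < maxn N n.+1) `|l%:R * empirical_fun R z l| <= _).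
    apply: (ler_sum_ord_widen (F := fun l => `|l%:R * empirical_fun R z l|)) => //.
    exact: leq_maxl.
  under eq_bigr do rewrite ger0_norm ?mulr_ge0 ?empirical_ge0//.
  rewrite (empirical_sum (phi := fun l => l%:R))//.
    by rewrite -natr_sum -/(mass z) zn mulVf// gt_eqF.
  by move=> x; have := le_mass z x; rewrite zn => H; rewrite leq_max; apply/orP; right.
Qed.

Lemma empirical_supp z i : mass z = n -> (n < i)%N -> empirical_fun R z i = 0.
Proof.
move=> zn ni; rewrite empiricalE big1 ?mulr0// => x _; rewrite /size_ind.
case: eqP => [zx|]; rewrite ?andbF//.
by have := le_mass z x; rewrite zn zx; lia.
Qed.

Lemma sum_coalesce (phi : nat -> R) z x y : phi 0%N = 0 -> y != x ->
  \sum_(w < n) phi (coalesce z x y w) =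
  \sum_(w < n) phi (z w) + (phi (z x + z y)%N - phi (z x) - phi (z y)).
Proof.
move=> p0 yx; have xy : x != y by rewrite eq_sym.
rewrite (bigD1 x)//= (bigD1 y)//= [in RHS](bigD1 x)//= [in RHS](bigD1 y)//=.
rewrite (eq_bigr (fun w => phi (z w))); last first.
  move=> w /andP[/negbTE wx /negbTE wy].
  by rewrite ffunE wx wy !muln0 addn0 subn0.
rewrite !ffunE !eqxx (negbTE xy) (negbTE yx) !muln0 !muln1 addn0 subn0 subnn p0.
by rewrite [(z y + _)%N]addnC; ring.
Qed.

Lemma mass_coalesce z x y : y != x -> mass (coalesce z x y) = mass z.
Proof.
move=> yx; have xy : x != y by rewrite eq_sym.
rewrite /mass (bigD1 x)//= (bigD1 y)//= [in RHS](bigD1 x)//= [in RHS](bigD1 y)//=.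
rewrite (eq_bigr (fun w => z w)); last first.
  move=> w /andP[/negbTE wx /negbTE wy].
  by rewrite ffunE wx wy !muln0 addn0 subn0.
rewrite !ffunE !eqxx (negbTE xy) (negbTE yx) !muln0 !muln1 addn0 subn0 subnn.
by rewrite add0n addnA [(z y + _)%N]addnC.
Qed.

Lemma empirical_coalesce z x y l : y != x -> empirical_fun R (coalesce z x y) l =
  empirical_fun R z l +
  n%:R^-1 * (size_ind l (z x + z y) - size_ind l (z x) - size_ind l (z y)).
Proof. by move=> yx; rewrite !empiricalE sum_coalesce ?size_ind0// mulrDr. Qed.

Definition moment2 z : R := n%:R^-1 * \sum_(x < n) (z x)%:R ^+ 2.

Lemma moment2_coalesce z x y : y != x ->
  moment2 (coalesce z x y) - moment2 z = n%:R^-1 * (2 * (z x)%:R * (z y)%:R).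
Proof.
move=> yx; rewrite /moment2 (@sum_coalesce (fun i => i%:R ^+ 2))//; last by rewrite expr0n.
by rewrite natrD; ring.
Qed.

Lemma mass_sum z : mass z = n -> \sum_(x < n) (z x)%:R = n%:R :> R.
Proof. by move=> zn; rewrite -natr_sum -/(mass z) zn. Qed.

(** The weight [l ^ 2] dominates l^1 by [l1_of_l2], and it is compatible with the
   equation by [smol_one_sided_lip]. *)
Definition sqdist M (b : nat -> R) z : R :=
  \sum_(l < M) l%:R ^+ 2 * (empirical_fun R z l - b l) ^+ 2.

Lemma sqdist_ge0 M b z : 0 <= sqdist M b z.
Proof. by apply: sumr_ge0 => i _; rewrite mulr_ge0// sqr_ge0. Qed.

Lemma moment2_ge0 z : 0 <= moment2 z.
Proof. by rewrite mulr_ge0// sumr_ge0// => i _; rewrite sqr_ge0. Qed.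

(** Half of the gradient of [sqdist] in the density. *)
Definition wdiff b z l : R := l%:R ^+ 2 * (empirical_fun R z l - b l).

Lemma sqdist_coalesce M b z x y : mass z = n -> (n + n < M)%N -> y != x ->
  sqdist M b (coalesce z x y) - sqdist M b z <=
  2 * n%:R^-1 * (wdiff b z (z x + z y) - wdiff b z (z x) - wdiff b z (z y)) +
  9 * n%:R^-1 ^+ 2 * ((z x)%:R ^+ 2 + (z y)%:R ^+ 2).
Proof.
move=> zn nM yx; set w := wdiff b z; have zx := le_mass z x; have zy := le_mass z y.
rewrite zn in zx zy.
pose d l : R := size_ind l (z x + z y) - size_ind l (z x) - size_ind l (z y).
have w0 : w 0%N = 0 by rewrite /w /wdiff expr0n mul0r.
have S (phi : nat -> R) : phi 0%N = 0 ->
    \sum_(l < M) phi l * d l = phi (z x + z y)%N - phi (z x) - phi (z y).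
  move=> p0; under eq_bigr do rewrite !mulrBr.
  by rewrite !sumrB !sum_size_ind//; lia.
rewrite /sqdist -sumrB.
rewrite (eq_bigr (fun l : 'I_M => 2 * n%:R^-1 * (w l * d l) +
    n%:R^-1 ^+ 2 * (l%:R ^+ 2 * d l ^+ 2))); last first.
  by move=> l _; rewrite empirical_coalesce// /w /wdiff /d; ring.
rewrite big_split/= -!mulr_sumr S// lerD2l.
rewrite [leRHS](_ : _ = n%:R^-1 ^+ 2 * (9 * ((z x)%:R ^+ 2 + (z y)%:R ^+ 2))); last by ring.
rewrite ler_wpM2l ?exprn_ge0//.
pose sq (l : nat) : R := l%:R ^+ 2.
have sq0 : sq 0%N = 0 by rewrite /sq expr0n.
apply: le_trans (_ : \sum_(l < M) 3 * (sq l * size_ind l (z x + z y) +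
    sq l * size_ind l (z x) + sq l * size_ind l (z y)) <= _).
  apply: ler_sum => l _; rewrite [leRHS](_ : _ = l%:R ^+ 2 *
      (3 * (size_ind l (z x + z y) + size_ind l (z x) + size_ind l (z y)))); last by rewrite /sq; ring.
  rewrite ler_wpM2l ?sqr_ge0//.
  rewrite /d /size_ind; case: (_ && _); case: (_ && _); case: (_ && _); rewrite /=; lra.
rewrite -mulr_sumr !big_split/= !sum_size_ind//; try lia.
rewrite /sq natrD; have := sqr_ge0 ((z x)%:R - (z y)%:R : R); nra.
Qed.

End configurations.

(** * The generator on the Lyapunov function *)

Section particles.
Variables (R : realType) (K : nat -> nat -> R) (C : R).
Hypothesis K_ge0 : forall i j, 0 <= K i j.
Hypothesis K_sym : forall i j, K i j = K j i.
Hypothesis K_le : forall i j, K i j <= C.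
Hypothesis K_0 : forall l, K 0%N l = 0.
Let C0 : 0 <= C := kernel_bound_ge0 K_ge0 K_le.

Variable n : nat.
Hypothesis n_gt0 : (0 < n)%N.
Implicit Types (z : config n) (x y : 'I_n).

Let n0 : 0 < n%:R :> R. Proof. by rewrite ltr0n. Qed.
Let ni0 : 0 <= n%:R^-1 :> R. Proof. by rewrite invr_ge0 ltW. Qed.

Lemma generator_moment2 z : mass z = n -> ml_generator K (@moment2 R n) z <= 2 * C.
Proof.
move=> zn; rewrite /ml_generator.
apply: le_trans (_ : n%:R^-1 * (\sum_(x < n) \sum_(y < n)
    C * (n%:R^-1 * (2 * (z x)%:R * (z y)%:R))) <= _).
  rewrite ler_wpM2l//; apply: ler_sum => x _; rewrite [leLHS]big_mkcond/=.
  apply: ler_sum => y _; have r0 : 0 <= n%:R^-1 * (2 * (z x)%:R * (z y)%:R) :> R.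
    by rewrite !mulr_ge0.
  case: ifP => [yx|_]; last by rewrite mulr_ge0.
  by rewrite moment2_coalesce// ler_wpM2r.
under eq_bigr do rewrite -mulr_sumr -mulr_sumr -mulr_sumr (mass_sum R zn).
rewrite -mulr_sumr -mulr_sumr -mulr_suml -mulr_sumr (mass_sum R zn).
rewrite le_eqVlt; apply/orP; left; apply/eqP; field.
by rewrite gt_eqF.
Qed.

Lemma pair_sum (psi : nat -> nat -> R) z N : (forall x, (z x < N)%N) ->
  \sum_(i < N) \sum_(j < N) K i j * empirical_fun R z i * empirical_fun R z j * psi i j =
  n%:R^-1 ^+ 2 * \sum_(x < n) \sum_(y < n) K (z x) (z y) * psi (z x) (z y).
Proof.
move=> zN; have KS l : K l 0%N = 0 by rewrite K_sym.
pose phi i : R := n%:R^-1 * \sum_(y < n) K i (z y) * psi i (z y).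
transitivity (\sum_(i < N) phi i * empirical_fun R z i).
  apply: eq_bigr => i _; rewrite /phi -(@empirical_sum R n (fun j => K i j * psi i j) z N)//.
    by rewrite mulr_suml; apply: eq_bigr => j _; ring.
  by rewrite KS mul0r.
rewrite (@empirical_sum R n phi)//; first by rewrite -mulr_sumr mulrA -expr2.
by rewrite /phi big1 ?mulr0// => y _; rewrite K_0 mul0r.
Qed.

(** The drift is twice the pairing of [wdiff] with the Smoluchowski operator, up to
   the pairs x = y, absent from the generator; as [wdiff] is at most [l], they
   contribute at most [8 * C / n]. The square of a jump gives the second moment. *)
Lemma generator_sqdist M b z : mass z = n -> fin_density b -> (n.+1 + n.+1 <= M)%N ->
  ml_generator K (sqdist M b) z <=
  2 * (\sum_(l < M) l%:R ^+ 2 * (empirical_fun R z l - b l) *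
        smoluchowski K (empirical_fun R z) l) +
  n%:R^-1 * (8 * C + 18 * C * moment2 R z).
Proof.
move=> zn bg nM; have pg := empirical_fin_density R n_gt0 zn.
pose w := wdiff b z.
pose D i j := w (i + j)%N - w i - w j.
have zN x : (z x < n.+1)%N by rewrite ltnS -[X in (_ <= X)%N]zn le_mass.
rewrite (@smol_weak R K C K_ge0 K_sym K_le K_0 _ n.+1 M w)//; last first.
  by move=> i ni; exact: empirical_supp.
rewrite -/D (@pair_sum D)//.
have wl l : `|w l| <= l%:R.
  have [_ pp _ p1] := pg; have [_ bp _ b1] := bg.
  have A := l1le_coord p1 l; have B := l1le_coord b1 l.
  have a0 : 0 <= l%:R * empirical_fun R z l by rewrite mulr_ge0.
  have c0 : 0 <= l%:R * b l by rewrite mulr_ge0.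
  rewrite ger0_norm// in A; rewrite ger0_norm// in B; rewrite /w /wdiff.
  rewrite expr2 -mulrA normrM normr_nat ler_piMr// ler_norml mulrBr.
  by apply/andP; split; lra.
have diag : `|\sum_(x < n) K (z x) (z x) * D (z x) (z x)| <= 4 * C * n%:R.
  apply: le_trans (ler_norm_sum _ _ _) _.
  rewrite -(mass_sum R zn) mulr_sumr; apply: ler_sum => x _.
  rewrite normrM ger0_norm// [4 * C]mulrC -mulrA.
  apply: ler_pM => //; have := wl (z x); have := wl (z x + z x)%N.
  by rewrite natrD !ler_norml /D => /andP[? ?] /andP[? ?]; apply/andP; split; lra.
rewrite /ml_generator.
apply: le_trans (_ : n%:R^-1 * (\sum_(x < n) (\sum_(y < n)
   (2 * n%:R^-1 * (K (z x) (z y) * D (z x) (z y)) +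
    9 * C * n%:R^-1 ^+ 2 * ((z x)%:R ^+ 2 + (z y)%:R ^+ 2)) -
   2 * n%:R^-1 * (K (z x) (z x) * D (z x) (z x)))) <= _).
  rewrite ler_wpM2l//; apply: ler_sum => x _.
  rewrite [in leRHS](bigD1 x)//=.
  have X0 : 0 <= 9 * C * n%:R^-1 ^+ 2 * ((z x)%:R ^+ 2 + (z x)%:R ^+ 2) :> R.
    by rewrite mulr_ge0 ?addr_ge0 ?sqr_ge0// mulr_ge0 ?exprn_ge0// mulr_ge0.
  rewrite [leRHS](_ : _ = 9 * C * n%:R^-1 ^+ 2 * ((z x)%:R ^+ 2 + (z x)%:R ^+ 2) +
    \sum_(y < n | y != x) (2 * n%:R^-1 * (K (z x) (z y) * D (z x) (z y)) +
    9 * C * n%:R^-1 ^+ 2 * ((z x)%:R ^+ 2 + (z y)%:R ^+ 2))); last by ring.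
  apply: ler_wpDl => //; apply: ler_sum => y yx.
  have nM' : (n + n < M)%N by lia.
  apply: le_trans (ler_wpM2l (K_ge0 _ _) (sqdist_coalesce n_gt0 b zn nM' yx)) _.
  rewrite mulrDr mulrCA -/w -/(D _ _) lerD2l.
  rewrite [leRHS](_ : _ = C * (9 * n%:R^-1 ^+ 2 * ((z x)%:R ^+ 2 + (z y)%:R ^+ 2))); last by ring.
  by rewrite ler_wpM2r// mulr_ge0 ?addr_ge0 ?sqr_ge0// mulr_ge0// exprn_ge0.
rewrite sumrB -mulr_sumr.
under eq_bigr do rewrite big_split/= -!mulr_sumr.
rewrite big_split/= -!mulr_sumr.
set S := \sum_(_ < _) \sum_(_ < _) K _ _ * _.
set E := \sum_(_ < _) K _ _ * _ in diag *.
have -> : \sum_(x < n) \sum_(y < n) ((z x)%:R ^+ 2 + (z y)%:R ^+ 2) =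
    2 * n%:R ^+ 2 * moment2 R z :> R.
  under eq_bigr do rewrite big_split/= sumr_const card_ord -[_ *+ n]mulr_natl.
  rewrite big_split/= -mulr_sumr sumr_const card_ord -[_ *+ n]mulr_natl /moment2.
  by field; rewrite gt_eqF.
move: diag; rewrite ler_norml => /andP[dl _].
rewrite [leRHS](_ : _ = n%:R^-1 * (2 * n%:R^-1 * S +
   9 * C * n%:R^-1 ^+ 2 * (2 * n%:R ^+ 2 * moment2 R z) + 8 * C)); last first.
  by field; rewrite gt_eqF.
rewrite ler_wpM2l// lerD2l.
rewrite -mulrN [leRHS](_ : _ = 2 * n%:R^-1 * (4 * C * n%:R)); last first.
  by field; rewrite gt_eqF.
by rewrite ler_wpM2l ?mulr_ge0//; lra.
Qed.

(** The second moment controls the noise in [sqdist]. *)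
Definition lyapunov M b z : R := sqdist M b z + n%:R^-1 * moment2 R z.

Lemma generator_lyapunov M b z : ml_generator K (lyapunov M b) z =
  ml_generator K (sqdist M b) z + n%:R^-1 * ml_generator K (@moment2 R n) z.
Proof.
rewrite /ml_generator -mulrDr; congr (_ * _).
rewrite mulr_sumr -big_split/=; apply: eq_bigr => x _; rewrite mulr_sumr -big_split/=.
by apply: eq_bigr => y _; rewrite /lyapunov; ring.
Qed.

(** Expanding the square around [a], the first-order terms in [h] combine into the
   pairing bounded by [smol_one_sided_lip]; the second-order terms are bounded
   by [smol_moment], uniformly in n. *)
Lemma lyapunov_step M N a z h : mass z = n -> fin_density a -> 0 <= h -> 2 * C * h <= 1 ->
  (forall i, (N <= i)%N -> a i = 0) -> (n < N)%N -> (N + N <= M)%N ->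
  lyapunov M (euler K h a) z + h * ml_generator K (lyapunov M (euler K h a)) z <=
  (1 + 18 * C * h) * lyapunov M a z + (10 * C * n%:R^-1 * h + 48 * C ^+ 2 * h ^+ 2).
Proof.
move=> zn ag h0 hC aN nN NM; have pg := empirical_fin_density R n_gt0 zn.
set b := euler K h a; have bg : fin_density b by exact: (euler_fin_density K_ge0 K_sym K_le K_0).
rewrite generator_lyapunov.
have m2 := generator_moment2 zn.
have LV := @generator_sqdist M b z zn bg ltac:(lia).
pose p := empirical_fun R z; rewrite -/p in LV.
pose k l := smoluchowski K a l; pose q l := smoluchowski K p l.
pose S1 := \sum_(l < M) l%:R ^+ 2 * (p l - a l) * k l.
pose S2 := \sum_(l < M) (l%:R * k l) * (l%:R * k l).
pose S3 := \sum_(l < M) l%:R ^+ 2 * (p l - a l) * q l.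
pose S4 := \sum_(l < M) (l%:R * k l) * (l%:R * q l).
have kb := smol_moment K_ge0 K_sym K_le K_0 ag.
have qb := smol_moment K_ge0 K_sym K_le K_0 pg.
have prod (u v : nat -> R) : l1le u (4 * C) -> l1le v (4 * C) ->
    `|\sum_(l < M) u l * v l| <= 16 * C ^+ 2.
  move=> ub vb; apply: le_trans (ler_norm_sum _ _ _) _.
  apply: le_trans (_ : \sum_(l < M) 4 * C * `|v l| <= _).
    apply: ler_sum => i _; rewrite normrM ler_wpM2r//; exact: l1le_coord ub i.
  rewrite -mulr_sumr (_ : 16 * C ^+ 2 = 4 * C * (4 * C)); last by ring.
  by rewrite ler_wpM2l ?mulr_ge0//; exact: vb.
have := prod _ _ kb kb; rewrite -/k -/S2 => S2b.
have := prod _ _ kb qb; rewrite -/k -/p -/q -/S4 => S4b.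
have VE : sqdist M b z = sqdist M a z - 2 * h * S1 + h ^+ 2 * S2.
  rewrite /sqdist /S1 /S2 !mulr_sumr -sumrB -big_split/=; apply: eq_bigr => l _.
  by rewrite /b /euler -/(k l) -/p; ring.
have WE : \sum_(l < M) l%:R ^+ 2 * (p l - b l) * smoluchowski K p l = S3 - h * S4.
  rewrite /S3 /S4 mulr_sumr -sumrB; apply: eq_bigr => l _.
  by rewrite /b /euler -/(k l) -/(q l); ring.
have SE : S3 - S1 <= 9 * C * sqdist M a z.
  have pN i : (N <= i)%N -> p i = 0 by move=> Ni; apply: empirical_supp => //; lia.
  apply: le_trans (smol_one_sided_lip K_ge0 K_sym K_le K_0 pg ag pN aN NM).
  by rewrite /S3 /S1 -sumrB; apply: ler_sum => l _; rewrite -mulrBr.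
rewrite WE in LV; rewrite /lyapunov VE.
have := ler_wpM2l h0 LV; have := ler_wpM2l h0 SE.
have := ler_wpM2l (mulr_ge0 h0 ni0) m2.
have m20 := moment2_ge0 R n_gt0 z; have V0 := sqdist_ge0 M a z.
move: S2b S4b; rewrite !ler_norml => /andP[_ S2b] /andP[S4b _].
have := ler_wpM2l (exprn_ge0 2 h0) S2b; have := ler_wpM2l (exprn_ge0 2 h0) S4b.
have : 0 <= C * h * n%:R^-1 * moment2 R z.
  by rewrite mulr_ge0// mulr_ge0// mulr_ge0.
move: m20 V0; rewrite -/b.
move: (ml_generator K (sqdist M b) z) (ml_generator K _ z) (moment2 R z) (sqdist M a z).
move=> W Q m A; lra.
Qed.

End particles.

(** * The transition function for small times *)

Section semigroup.
Variables (R : realType) (K : nat -> nat -> R) (C : R).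
Hypothesis K_ge0 : forall i j, 0 <= K i j.
Hypothesis K_le : forall i j, K i j <= C.
Let C0 : 0 <= C := kernel_bound_ge0 K_ge0 K_le.
Variable n : nat.
Implicit Types (z : config n) (f : config n -> R) (t h : R).

Local Notation L := (@ml_generator R K n).

Definition point_fun z' : config n -> R := fun z => (z == z')%:R.

Lemma generator_bound f B : (forall z, `|f z| <= B) ->
  forall z, `|L f z| <= 2 * n%:R * C * B.
Proof.
move=> fB z; have B0 : 0 <= B := le_trans (normr_ge0 _) (fB z).
have [n0|n0] := posnP n.
  rewrite /ml_generator big1 ?mulr0 ?normr0 ?mulr_ge0// => x _.
  by have := ltn_ord x; rewrite [X in (_ < X)%N]n0.
rewrite /ml_generator normrM normfV normr_nat ler_pdivrMl ?ltr0n//.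
apply: le_trans (ler_norm_sum _ _ _) _.
apply: le_trans (_ : \sum_(x < n) \sum_(y < n) C * (2 * B) <= _); last first.
  rewrite !sumr_const !card_ord -mulrnA -[_ *+ (n * n)]mulr_natl natrM le_eqVlt; apply/orP; left; apply/eqP; ring.
apply: ler_sum => x _; apply: le_trans (ler_norm_sum _ _ _) _.
rewrite [leLHS]big_mkcond/=; apply: ler_sum => y _.
case: ifP => [_|_]; last by rewrite !mulr_ge0.
rewrite normrM ger0_norm//; apply: ler_pM => //.
by apply: le_trans (ler_normB _ _) _; have := fB (coalesce z x y); have := fB z; lra.
Qed.

Lemma iter_generator_bound f B k : (forall z, `|f z| <= B) ->
  forall z, `|iter k L f z| <= (2 * n%:R * C) ^+ k * B.
Proof.
move=> fB; elim: k => [|k IH] z; first by rewrite expr0 mul1r.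
by rewrite exprS -mulrA /=; exact: generator_bound.
Qed.

Lemma point_fun_bound z' z : `|point_fun z' z| <= 1.
Proof. by rewrite normr_nat lern1 leq_b1. Qed.

Definition trans_coef t z z' k := t ^+ k / k`!%:R * iter k L (point_fun z') z.

Lemma transitionE t z z' : transition L t z z' = isum (trans_coef t z z').
Proof.
rewrite /transition /isum; apply: (congr1 (fun F : nat -> R => limn F)).
by apply/funext => N; rewrite big_mkord.
Qed.

Lemma exp_partial (x : R) N : 0 <= x -> \sum_(k < N) x ^+ k / k`!%:R <= expR x.
Proof.
move=> x0; rewrite -[leLHS](_ : series (exp_coeff x) N = _); last by rewrite seriesEord.
apply: nondecreasing_cvgn_le; last exact: is_cvg_series_exp_coeff.
move=> a b ab; rewrite !seriesEord/=.
apply: (ler_sum_ord_widen (F := fun k => x ^+ k / k`!%:R)) => // i.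
by rewrite divr_ge0// exprn_ge0.
Qed.

Lemma trans_coef_bound t z z' k : 0 <= t ->
  `|trans_coef t z z' k| <= (t * (2 * n%:R * C)) ^+ k / k`!%:R.
Proof.
move=> t0; rewrite /trans_coef normrM ger0_norm ?divr_ge0 ?exprn_ge0//.
rewrite exprMn [leRHS]mulrAC ler_wpM2l ?divr_ge0 ?exprn_ge0//.
by have := iter_generator_bound k (point_fun_bound z') z; rewrite mulr1.
Qed.

Lemma trans_coef_l1le t z z' : 0 <= t ->
  l1le (trans_coef t z z') (expR (t * (2 * n%:R * C))).
Proof.
move=> t0 N; apply: le_trans (exp_partial N _); last by rewrite !mulr_ge0.
by apply: ler_sum => k _; exact: trans_coef_bound.
Qed.

Lemma transition_taylor h z z' : 0 <= h -> h * (2 * n%:R * C) <= 1 ->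
  `|transition L h z z' - (point_fun z' z + h * L (point_fun z') z)| <=
    (h * (2 * n%:R * C)) ^+ 2 * expR 1.
Proof.
move=> h0; set x := h * _ => x1; have x0 : 0 <= x by rewrite !mulr_ge0.
(* [g] keeps the terms of order 0 and 1 of the exponential series. *)
pose g k := if (k < 2)%N then trans_coef h z z' k else 0.
have gE : isum g = point_fun z' z + h * L (point_fun z') z.
  rewrite (@isum_fin _ _ 2); last by move=> i i2; rewrite /g ltnNge i2.
  by rewrite !big_ord_recr big_ord0/= /g /trans_coef/= expr0 expr1 !divr1 mul1r add0r.
have gl : l1le g (expR x).
  apply: l1le_dom (trans_coef_l1le z z' h0) => k.
  by rewrite /g; case: ifP; rewrite ?normr0.
rewrite transitionE -gE -(isumB (trans_coef_l1le z z' h0) gl).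
apply: isum_norm_le => N.
apply: le_trans (_ : \sum_(k < N) x ^+ 2 * (1 ^+ k / k`!%:R) <= _); last first.
  by rewrite -mulr_sumr ler_wpM2l ?exprn_ge0//; exact: exp_partial.
apply: ler_sum => k _; rewrite /g expr1n; case: ltnP => k2.
  by rewrite subrr normr0 mulr_ge0 ?exprn_ge0// divr_ge0.
rewrite subr0; apply: le_trans (trans_coef_bound _ _ _ h0) _.
rewrite mul1r ler_wpM2r// -/x -(subnKC k2) exprD ler_piMr ?exprn_ge0//.
by rewrite exprn_ile1.
Qed.

(** The transition function charges only pairs related by every relation that is
   reflexive and stable under prepending a jump: all the powers of the generator
   vanish on the other pairs. *)
Lemma transition_eq0 (Q : config n -> config n -> Prop) t z z' :
  (forall z, Q z z) ->
  (forall z x y z', y != x -> K (z x) (z y) != 0 -> Q (coalesce z x y) z' -> Q z z') ->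
  ~ Q z z' -> transition L t z z' = 0.
Proof.
move=> Qr Qs nQ.
have H k : forall z, ~ Q z z' -> iter k L (point_fun z') z = 0.
  elim: k => [|k IH] w nw.
    by rewrite /= /point_fun; case: eqP => // wz; case: nw; rewrite wz.
  rewrite /= /ml_generator big1 ?mulr0// => x _; rewrite big1// => y yx.
  have [->|K0] := eqVneq (K (w x) (w y)) 0; first by rewrite mul0r.
  by rewrite (IH w)// IH ?subrr ?mulr0// => /(Qs _ _ _ _ yx K0).
rewrite transitionE (@isum_fin _ _ 0) ?big_ord0// => i _.
by rewrite /trans_coef H ?mulr0.
Qed.

(** The finite set of configurations visited by the chain, whose mass is conserved. *)
Definition slice : seq (config n) :=
  [seq z <- undup [seq [ffun x => val (f x)] | f : {ffun 'I_n -> 'I_n.+1}] | mass z == n].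

Lemma mem_slice z : (z \in slice) = (mass z == n).
Proof.
rewrite mem_filter andb_idr// => /eqP zn; rewrite mem_undup.
apply/mapP; exists [ffun x => inord (z x)]; first by rewrite mem_enum.
apply/ffunP => x; rewrite !ffunE /= inordK// ltnS -[X in (_ <= X)%N]zn.
exact: le_mass.
Qed.

Lemma slice_uniq : uniq slice.
Proof. by rewrite filter_uniq// undup_uniq. Qed.

Lemma sum_point_fun f z : z \in slice -> \sum_(z' <- slice) f z' * point_fun z' z = f z.
Proof.
move=> zS; rewrite (bigD1_seq z)//= ?slice_uniq// /point_fun eqxx mulr1 big1 ?addr0//.
by move=> w; rewrite eq_sym => /negbTE ->; rewrite mulr0.
Qed.

Lemma generator_slice f z : z \in slice ->
  \sum_(z' <- slice) f z' * L (point_fun z') z = L f z.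
Proof.
move=> zS; rewrite /ml_generator.
under eq_bigr do rewrite mulrCA mulr_sumr.
rewrite -mulr_sumr exchange_big/=; congr (_ * _); apply: eq_bigr => x _.
under eq_bigr do rewrite mulr_sumr.
rewrite exchange_big/=; apply: eq_bigr => y yx.
under eq_bigr do rewrite mulrCA mulrBr.
rewrite -mulr_sumr sumrB !sum_point_fun// mem_slice mass_coalesce//.
by rewrite -mem_slice.
Qed.

Lemma transition_expectation f B h z : 0 <= h -> h * (2 * n%:R * C) <= 1 ->
  (forall z, z \in slice -> `|f z| <= B) -> z \in slice ->
  `|\sum_(z' <- slice) f z' * transition L h z z' - (f z + h * L f z)| <=
    (size slice)%:R * (B * ((h * (2 * n%:R * C)) ^+ 2 * expR 1)).
Proof.
move=> h0 h1 fB zS.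
rewrite -{1}(sum_point_fun f zS) -(generator_slice f zS) mulr_sumr -big_split/= -sumrB.
apply: le_trans (ler_norm_sum _ _ _) _.
apply: le_trans (_ : \sum_(z' <- slice) B * ((h * (2 * n%:R * C)) ^+ 2 * expR 1) <= _).
  rewrite big_seq [leRHS]big_seq; apply: ler_sum => w wS.
  rewrite (_ : _ - _ = f w * (transition L h z w - (point_fun w z + h * L (point_fun w) z))); last by ring.
  rewrite normrM; apply: ler_pM => //; first exact: fB.
  exact: transition_taylor.
by rewrite big_const_seq count_predT iter_addr_0 -[_ *+ size _]mulr_natl.
Qed.

End semigroup.

(** * One-dimensional laws of the chain *)

Section chain_law.
Variables (R : realType) (K : nat -> nat -> R) (C : R).
Hypothesis K_ge0 : forall i j, 0 <= K i j.
Hypothesis K_sym : forall i j, K i j = K j i.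
Hypothesis K_le : forall i j, K i j <= C.
Hypothesis K_0 : forall l, K 0%N l = 0.
Let C0 : 0 <= C := kernel_bound_ge0 K_ge0 K_le.
Variable n : nat.
Hypothesis n_gt0 : (0 < n)%N.
Variables (d : measure_display) (Omega : measurableType d)
  (P : probability Omega R) (X : R -> Omega -> config n).
Hypothesis X_chain : markov_chain (@ml_generator R K n) (monodisperse n) P X.
Implicit Types (z : config n) (s t h : R).

Local Notation L := (@ml_generator R K n).
Local Notation z0 := (monodisperse n).
Local Notation S := (slice n).

Lemma measurable_event (D : config n -> Prop) t : 0 <= t ->
  measurable [set w | D (X t w)].
Proof.
move=> t0; pose F (k : nat) := if unpickle k is Some z then
  (if `[< D z >] then [set w | X t w = z] else set0) else set0 : set Omega.
rewrite (_ : [set w | _] = \bigcup_k F k).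
  apply: bigcupT_measurable => k; rewrite /F; case: unpickle => // z.
  by case: asboolP => // _; exact: mc_measurable X_chain _ _ t0.
apply/seteqP; split=> w /=.
  move=> Dw; exists (pickle (X t w)) => //; rewrite /F pickleK.
  by case: asboolP.
by case=> k _; rewrite /F; case: unpickle => // z; case: asboolP => //= Dz ->.
Qed.

Lemma negligible_event (D : config n -> Prop) t : 0 <= t ->
  (forall z, D z -> P [set w | X t w = z] = 0%E) -> P [set w | D (X t w)] = 0%E.
Proof.
move=> t0 D0; apply/negligibleP; first exact: measurable_event.
pose F (k : nat) := if unpickle k is Some z then
  (if `[< D z >] then [set w | X t w = z] else set0) else set0 : set Omega.
apply: (@negligibleS _ _ _ _ (\bigcup_k F k)).
  move=> w /= Dw; exists (pickle (X t w)) => //; rewrite /F pickleK.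
  by case: asboolP.
apply: negligible_bigcup => k; rewrite /F; case: unpickle => [z|]; last exact: negligible_set0.
case: asboolP => [Dz|_]; last exact: negligible_set0.
by apply/negligibleP; [exact: mc_measurable X_chain _ _ t0|exact: D0].
Qed.

Lemma full_setI (A B : set Omega) : measurable A -> measurable B ->
  P (~` A) = 0%E -> P (B `&` A) = P B.
Proof.
move=> mA mB A0; rewrite -[in RHS](setIT B) -(setUv A) setIUr measureU0//.
- exact: measurableI.
- by apply: measurableI => //; exact: measurableC.
- apply/eqP; rewrite -measure_le0 -A0; apply: le_measure; rewrite ?inE.
  + by apply: measurableI => //; exact: measurableC.
  + exact: measurableC.
  + exact: subIsetr.
Qed.

Definition law t z : R := transition L t z0 z.

Lemma visits_nil : visits X [::] = setT.
Proof. by apply/seteqP; split=> // w _ p. Qed.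

Lemma P_law t z : 0 <= t -> P [set w | X t w = z] = (law t z)%:E.
Proof.
move=> t0.
have := mc_markov X_chain z0 z (lexx 0) t0 (h := [::]) (fun p (h : p \in [::]) => ltac:(by [])).
rewrite visits_nil setTI (mc_init X_chain) mul1e add0r setIC => <-.
have m0 : measurable [set w | X 0 w = z0] by exact: (measurable_event (eq^~ z0)).
rewrite full_setI//; first exact: (measurable_event (eq^~ z)).
rewrite probability_setC//.
by rewrite (mc_init X_chain) subee.
Qed.

Lemma law_ge0 t z : 0 <= t -> 0 <= law t z.
Proof. by move=> t0; rewrite -lee_fin -P_law. Qed.

Lemma P_law2 s t z z' : 0 <= s -> 0 <= t ->
  P ([set w | X s w = z] `&` [set w | X (s + t) w = z']) =
  (law s z * transition L t z z')%:E.
Proof.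
move=> s0 t0.
have := mc_markov X_chain z z' s0 t0 (h := [::]) (fun p (h : p \in [::]) => ltac:(by [])).
by rewrite visits_nil setTI P_law// EFinM.
Qed.

Lemma mass_monodisperse : mass z0 = n.
Proof.
rewrite /mass; under eq_bigr do rewrite ffunE.
by rewrite sum1_card card_ord.
Qed.

Lemma slice_full t : 0 <= t -> P (~` [set w | X t w \in S]) = 0%E.
Proof.
move=> t0; apply: (negligible_event (D := fun z => ~ z \in S)) => // z.
rewrite mem_slice => zn; rewrite P_law// /law.
rewrite (transition_eq0 (Q := fun z z' => mass z = mass z'))//.
  by move=> w x y w' yx _; rewrite mass_coalesce.
by move=> h; apply: zn; apply/eqP; rewrite -h mass_monodisperse.
Qed.

Lemma P_slice (B : set Omega) t (s : seq (config n)) : 0 <= t -> measurable B -> uniq s ->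
  P (B `&` [set w | X t w \in s]) = (\sum_(z <- s) P (B `&` [set w | X t w = z]))%E.
Proof.
move=> t0 mB; elim: s => [_|z s IH /andP[zs us]].
  rewrite big_nil (_ : _ `&` _ = set0) ?measure0//.
  by apply/seteqP; split=> // w [].
rewrite big_cons -IH// -measureU.
- congr (P _); rewrite -setIUr; congr (_ `&` _); apply/seteqP; split=> w /=.
    by rewrite inE => /orP[/eqP|]; [left|right].
  by case=> [->|ws]; rewrite inE ?eqxx// ws orbT.
- by apply: measurableI => //; exact: (measurable_event (eq^~ z)).
- by apply: measurableI => //; exact: (measurable_event (fun y => y \in s)).
- apply/seteqP; split=> // w [[_ /= Xz] [_ /=]]; rewrite Xz => h.
  by rewrite h in zs.
Qed.

Lemma P_total (B : set Omega) t : 0 <= t -> measurable B ->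
  P B = (\sum_(z <- S) P (B `&` [set w | X t w = z]))%E.
Proof.
move=> t0 mB; rewrite -P_slice ?slice_uniq// full_setI//; last exact: slice_full.
exact: (measurable_event (fun y => y \in S)).
Qed.

Lemma law_add s t z' : 0 <= s -> 0 <= t ->
  law (s + t) z' = \sum_(z <- S) law s z * transition L t z z'.
Proof.
move=> s0 t0; apply/EFin_inj; rewrite -P_law ?addr_ge0//.
rewrite (P_total s0); last by apply: (measurable_event (eq^~ z')); rewrite addr_ge0.
by rewrite -sumEFin; apply: eq_bigr => z _; rewrite setIC P_law2.
Qed.

Lemma sum_law t : 0 <= t -> \sum_(z <- S) law t z = 1.
Proof.
move=> t0; apply/EFin_inj; rewrite -(@probability_setT _ _ _ P) (P_total t0)//.
by rewrite -sumEFin; apply: eq_bigr => z _; rewrite setTI P_law.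
Qed.

Definition expect t (f : config n -> R) := \sum_(z <- S) law t z * f z.

Lemma expect_le t f g : 0 <= t -> (forall z, mass z = n -> f z <= g z) ->
  expect t f <= expect t g.
Proof.
move=> t0 fg; rewrite /expect big_seq [leRHS]big_seq; apply: ler_sum => z.
by rewrite mem_slice => /eqP zn; rewrite ler_wpM2l ?law_ge0// fg.
Qed.

Lemma expect_affine t a b f : 0 <= t ->
  expect t (fun z => a * f z + b) = a * expect t f + b.
Proof.
move=> t0; rewrite /expect.
under eq_bigr do rewrite mulrDr mulrCA.
by rewrite big_split/= -mulr_sumr -mulr_suml sum_law// mul1r.
Qed.

(** The factor 3 bounds [lyapunov] on the slice. *)
Definition taylor_const : R :=
  (size S)%:R * (3 * ((2 * n%:R * C) ^+ 2 * expR 1)).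

Lemma taylor_const_ge0 : 0 <= taylor_const.
Proof. by rewrite mulr_ge0// mulr_ge0// mulr_ge0 ?sqr_ge0// expR_ge0. Qed.

Lemma expect_step t h f : 0 <= t -> 0 <= h -> h * (2 * n%:R * C) <= 1 ->
  (forall z, z \in S -> `|f z| <= 3) ->
  expect (t + h) f <= expect t (fun z => f z + h * L f z) + taylor_const * h ^+ 2.
Proof.
move=> t0 h0 h1 f3.
have -> : expect (t + h) f =
    \sum_(z <- S) law t z * (\sum_(z' <- S) f z' * transition L h z z').
  rewrite /expect; under eq_bigr do rewrite (law_add _ t0 h0) mulr_suml.
  rewrite exchange_big/=; apply: eq_bigr => z _; rewrite mulr_sumr.
  by apply: eq_bigr => z' _; ring.
rewrite -[X in _ <= X](_ : \sum_(z <- S) law t z *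
    (f z + h * L f z + taylor_const * h ^+ 2) = _); last first.
  have := @expect_affine t 1 (taylor_const * h ^+ 2) (fun z => f z + h * L f z) t0.
  by rewrite mul1r => <-; apply: eq_bigr => z _; rewrite mul1r.
rewrite big_seq [leRHS]big_seq; apply: ler_sum => z zS.
rewrite ler_wpM2l ?law_ge0// -lerBlDl.
have := transition_expectation K_ge0 K_le h0 h1 f3 zS.
move=> /(le_trans (ler_norm _))/le_trans; apply.
by rewrite /taylor_const exprMn le_eqVlt; apply/orP; left; apply/eqP; ring.
Qed.

Lemma expect0 f : expect 0 f = f z0.
Proof.
have zS : z0 \in S by rewrite mem_slice mass_monodisperse.
rewrite /expect -(sum_point_fun f zS); apply: eq_bigr => z _; rewrite mulrC; congr (_ * _).
have := @transition_taylor _ K C K_ge0 K_le n 0 z0 z (lexx 0).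
by rewrite !mul0r expr0n mul0r addr0 normr_le0 subr_eq0 => /(_ ler01)/eqP.
Qed.

(** Grönwall along the Euler scheme: the generator dissipates the Lyapunov
   function up to a noise of order 1/n. The cutoff [M] depends on the number of
   steps because each step may double the support of the scheme. *)
Lemma expect_lyapunov h k : 0 <= h -> 2 * C * h <= 1 -> h * (2 * n%:R * C) <= 1 ->
  exists M, [/\ (n < M)%N, (forall i, (M <= i)%N -> euler_path K h k i = 0) &
    expect (k%:R * h) (sqdist M (euler_path K h k)) <=
    expR (18 * C * h * k%:R) * (n%:R^-1 +
      (10 * C * n%:R^-1 * h + (48 * C ^+ 2 + taylor_const) * h ^+ 2) * k%:R)].
Proof.
move=> h0 h1 h2.
have G i := euler_path_fin_density K_ge0 K_sym K_le K_0 i h0 h1.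
have [N nN HN] : exists2 N, (n < N)%N & forall j, (j <= k)%N ->
    forall i, (N <= i)%N -> euler_path K h j i = 0.
  elim: k => [|k [N nN IH]].
    by exists n.+2 => // j; rewrite leqn0 => /eqP -> [|[|i]].
  have [_ _ [N' HN'] _] := G k.+1.
  exists (maxn N N') => [|j]; first by rewrite leq_max nN.
  rewrite leq_eqVlt => /orP[/eqP ->|jk] i; rewrite geq_max => /andP[a b].
    exact: HN'.
  exact: IH.
pose M := (N + N)%N; exists M.
have NM : (N <= M)%N by rewrite /M leq_addr.
split; [exact: leq_trans nN NM|by move=> i Mi; apply: HN => //; exact: leq_trans NM Mi|].
pose A := 18 * C * h.
pose B := 10 * C * n%:R^-1 * h + (48 * C ^+ 2 + taylor_const) * h ^+ 2.
have ni0 : 0 <= n%:R^-1 :> R by rewrite invr_ge0.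
have A0 : 0 <= A by rewrite !mulr_ge0.
have B0 : 0 <= B.
  rewrite addr_ge0 ?mulr_ge0 ?exprn_ge0// addr_ge0 ?taylor_const_ge0//.
  by rewrite mulr_ge0// exprn_ge0.
have bound j z : mass z = n -> `|lyapunov M (euler_path K h j) z| <= 3.
  move=> zn; rewrite ger0_norm; last first.
    by rewrite addr_ge0 ?sqdist_ge0// mulr_ge0 ?(moment2_ge0 R n_gt0).
  rewrite [leRHS](_ : _ = (1 + 1) + 1); last by ring.
  have pg := empirical_fin_density R n_gt0 zn; have [_ pp _ p1] := pg; have [_ bp _ b1] := G j.
  have [_ _ pl] := fin_density_subprob pg; have [_ _ bl] := fin_density_subprob (G j).
  apply: lerD.
    apply: le_trans (lerD (p1 M) (b1 M)); rewrite -big_split/=.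
    apply: ler_sum => i _.
    have := l1le_coord pl i; have := l1le_coord bl i; have := l1le_coord p1 i; have := l1le_coord b1 i.
    have := pp i; have := bp i.
    rewrite !normrM !normr_nat; move=> bi0 pi0; rewrite !ger0_norm//.
    set p := empirical_fun R z i; set b := euler_path K h j i => c1 c2 c3 c4.
    have i0 : 0 <= i%:R :> R by [].
    rewrite -exprMn.
    have : (i%:R * (p - b)) ^+ 2 <= `|i%:R * (p - b)|.
      rewrite -real_normK ?num_real// expr2 ler_piMr// ler_norml mulrBr.
      have : 0 <= i%:R * p by rewrite mulr_ge0.
      have : 0 <= i%:R * b by rewrite mulr_ge0.
      by move=> *; apply/andP; split; lra.
    move/le_trans; apply; rewrite ler_norml mulrBr.
    have : 0 <= i%:R * p by rewrite mulr_ge0.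
    have : 0 <= i%:R * b by rewrite mulr_ge0.
    by move=> *; apply/andP; split; lra.
  rewrite /moment2 mulrA -expr2 exprVn -[leRHS](@mulVf _ (n%:R ^+ 2)); last first.
    by rewrite expf_neq0// pnatr_eq0 -lt0n.
  rewrite ler_wpM2l ?invr_ge0 ?exprn_ge0//.
  rewrite expr2 -{1}(mass_sum R zn) mulr_suml; apply: ler_sum => x _.
  by rewrite expr2 ler_wpM2l// ler_nat -[X in (_ <= X)%N]zn le_mass.
pose e j := expect (j%:R * h) (lyapunov M (euler_path K h j)).
have eS j : (j < k)%N -> e j.+1 <= (1 + A) * e j + B.
  move=> jk; have jh : 0 <= j%:R * h by rewrite mulr_ge0.
  rewrite /e -natr1 mulrDl mul1r.
  apply: le_trans (expect_step jh h0 h2 _) _.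
    by move=> z; rewrite mem_slice => /eqP; exact: bound.
  rewrite -[leRHS](_ : (1 + A) * expect (j%:R * h) (lyapunov M (euler_path K h j)) +
     (10 * C * n%:R^-1 * h + 48 * C ^+ 2 * h ^+ 2) + taylor_const * h ^+ 2 = _); last first.
    by rewrite /B; ring.
  rewrite lerD2r -expect_affine//; apply: expect_le => // z zn.
  apply: (lyapunov_step K_ge0 K_sym K_le K_0 n_gt0 zn (G j) h0 h1 _ nN (leqnn _)).
  by move=> i; apply: HN; exact: ltnW.
have e0 : e 0%N = n%:R^-1.
  have nn : n%:R != 0 :> R by rewrite pnatr_eq0 -lt0n.
  rewrite /e mul0r expect0 /lyapunov /sqdist big1 ?add0r.
    rewrite /moment2; under eq_bigr do rewrite ffunE expr1n.
    by rewrite sumr_const card_ord -mulr_natl mulr1 mulVf// mulr1.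
  move=> l _; rewrite empiricalE; under eq_bigr do rewrite ffunE.
  rewrite sumr_const card_ord -[size_ind R l 1 *+ n]mulr_natl mulKf// /size_ind /= /delta1_fun.
  by case: (nat_of_ord l) => [|[|i]]; rewrite /= subrr expr0n mulr0.
(* past [k] the scheme is no longer supported in [0, N) *)
pose e' j := if (j <= k)%N then e j else iter (j - k) (fun x => (1 + A) * x + B) (e k).
have e'S j : e' j.+1 <= (1 + A) * e' j + B.
  rewrite /e'; case: (ltnP j k) => [jk|kj].
    by rewrite (ltnW jk) eS.
  rewrite subSn//= ; case: (leqP j k) => [jk|//].
  have -> : j = k by lia.
  by rewrite subnn.
have := discrete_gronwall A0 B0 _ e'S k.
rewrite /e' leqnn leq0n e0 => /(_ ni0); apply: le_trans.
apply: expect_le; first by rewrite mulr_ge0.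
by move=> z zn; rewrite /lyapunov lerDl mulr_ge0 ?(moment2_ge0 R n_gt0).
Qed.

End chain_law.

(** * The law of large numbers at a fixed time *)

Section fixed_time.
Variables (R : realType) (K : nat -> nat -> R) (C : R).
Hypothesis K_ge0 : forall i j, 0 <= K i j.
Hypothesis K_sym : forall i j, K i j = K j i.
Hypothesis K_le : forall i j, K i j <= C.
Hypothesis K_0 : forall l, K 0%N l = 0.
Let C0 : 0 <= C := kernel_bound_ge0 K_ge0 K_le.
Variable n : nat.
Hypothesis n_gt0 : (0 < n)%N.
Variables (d : measure_display) (Omega : measurableType d)
  (P : probability Omega R) (X : R -> Omega -> config n).
Hypothesis X_chain : markov_chain (@ml_generator R K n) (monodisperse n) P X.
Implicit Types (z : config n) (s t h : R).

Local Notation S := (slice n).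
Local Notation u := (solution K_ge0 K_sym K_le K_0).

Lemma P_event (D : config n -> Prop) t : 0 <= t ->
  P [set w | D (X t w)] = (\sum_(z <- S | `[< D z >]) law K t z)%:E.
Proof.
move=> t0; rewrite (P_total X_chain t0); last exact: measurable_event X_chain _ _ t0.
rewrite [in RHS]big_mkcond -sumEFin; apply: eq_bigr => z _.
case: asboolP => Dz.
  rewrite -(P_law X_chain)//; congr (P _); apply/seteqP; split=> w /=.
    by case.
  by move=> ->.
rewrite (_ : _ `&` _ = set0) ?measure0//.
by apply/seteqP; split=> // w /= [Dw Xz]; apply: Dz; rewrite -Xz.
Qed.

Lemma empirical_close z M b lam e t : mass z = n -> (n < M)%N -> 0 < lam ->
  b 0%N = 0 -> (forall i, (M <= i)%N -> b i = 0) ->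
  l1le (fun l => b l - u t l) e -> e < lam / 2 ->
  2 * lam <= l1dist (empirical R z) (u t) -> lam ^+ 2 <= sqdist M b z.
Proof.
move=> zn nM lam0 b0 bM be elam; apply: contraTT; rewrite -!ltNge => V.
pose v l := empirical_fun R z l - b l.
have v0 : v 0%N = 0 by rewrite /v b0 subr0.
have vM i : (M <= i)%N -> v i = 0.
  move=> Mi; rewrite /v bM// subr0; apply: empirical_supp => //; exact: leq_trans nM Mi.
have L1 := l1_of_l2 v0 lam0 (ltW V).
have H : l1le v (lam + lam ^+ 2 / (2 * lam)) by exact: l1le_le (supp_l1le vM) L1.
apply: (@le_lt_trans _ _ (lam + lam ^+ 2 / (2 * lam) + e)).
  by apply/l1dist_leP; exact: l1le_triangle H be.
rewrite (_ : lam ^+ 2 / (2 * lam) = lam / 2); first by lra.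
by field; rewrite gt_eqF.
Qed.

(** Chebyshev's inequality at a fixed time, the Euler step going to zero. *)
Lemma law_large_numbers t lam : 0 <= t -> 0 < lam ->
  (P [set w | (2 * lam <= l1dist (empirical R (X t w)) (u t))%R] <=
   ((lam ^+ 2)^-1 * (expR (18 * C * t) * (1 + 10 * C * t)) * n%:R^-1)%:E)%E.
Proof.
move=> t0 lam0; pose D z : Prop := 2 * lam <= l1dist (empirical R z) (u t).
rewrite (P_event D t0) lee_fin.
pose e1 := expR (6 * C * t) * (36 * C ^+ 2 * t).
apply: (@le_of_harmonic _ _ _ ((lam ^+ 2)^-1 * (expR (18 * C * t) *
   ((48 * C ^+ 2 + taylor_const C n) * t ^+ 2)))).
have lam2 : 0 < lam / 2 by rewrite divr_gt0.
near=> m.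
pose h := t * m.+1%:R^-1; have h0 : 0 <= h by rewrite mulr_ge0.
have mh : m.+1%:R * h = t by rewrite /h mulrC divfK// pnatr_eq0.
have h1 : 2 * C * h <= 1.
  by rewrite /h mulrA ltW//; near: m; exact: near_harmonic_lt.
have h2 : h * (2 * n%:R * C) <= 1.
  by rewrite /h mulrAC ltW//; near: m; exact: near_harmonic_lt.
have h3 : e1 * h < lam / 2.
  by rewrite /h mulrA; near: m; exact: near_harmonic_lt.
have [M [nM bM EM]] := expect_lyapunov K_ge0 K_sym K_le K_0 n_gt0 X_chain m.+1 h0 h1 h2.
set b := euler_path K h m.+1 in bM EM.
have [b0 _ _ _] : fin_density b by exact: (euler_path_fin_density K_ge0 K_sym K_le K_0).
have be : l1le (fun l => b l - u t l) (e1 * h).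
  have := euler_path_flow K_ge0 K_sym K_le K_0 m.+1 h0 h1.
  rewrite mh -(solutionE K_ge0 K_sym K_le K_0 t0) => H; apply: l1le_le H _.
  by rewrite /e1 le_eqVlt; apply/orP; left; apply/eqP; ring.
rewrite mh in EM.
have Markov : lam ^+ 2 * \sum_(z <- S | `[< D z >]) law K t z <=
    expect K t (sqdist M b : config n -> R).
  rewrite mulr_sumr /expect big_mkcond big_seq [leRHS]big_seq; apply: ler_sum => z.
  rewrite mem_slice => /eqP zn; case: asboolP => Dz.
    rewrite mulrC ler_wpM2l ?(law_ge0 X_chain)//.
    exact: empirical_close zn nM lam0 b0 bM be h3 Dz.
  by rewrite mulr_ge0 ?(law_ge0 X_chain)// sqdist_ge0.
have l20 : 0 < lam ^+ 2 by rewrite exprn_gt0.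
rewrite -(@ler_pM2l _ (lam ^+ 2))//; apply: le_trans Markov _.
apply: le_trans EM _.
rewrite (_ : 18 * C * h * m.+1%:R = 18 * C * t); last by rewrite -mh; ring.
rewrite le_eqVlt; apply/orP; left; apply/eqP; rewrite /h.
field; rewrite !gt_eqF ?ltr0n//.
Unshelve. all: by end_near. Qed.

End fixed_time.

(** * Monotonicity of the number of clusters *)

Section coalescence.
Variables (R : realType) (K : nat -> nat -> R).
Hypothesis K_sym : forall i j, K i j = K j i.
Hypothesis K_0 : forall l, K 0%N l = 0.
Variable n : nat.
Hypothesis n_gt0 : (0 < n)%N.
Implicit Types (z : config n).

Let ni0 : 0 <= n%:R^-1 :> R. Proof. by rewrite invr_ge0. Qed.

Definition clusters z : R := \sum_(x < n) (z x != 0%N)%:R.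

(** What is needed of the relation of being obtained by coalescences: each of
   these removes one cluster and changes three values of the density by 1/n. *)
Definition reach z z' := l1le (fun l => empirical_fun R z l - empirical_fun R z' l)
  (3 * n%:R^-1 * (clusters z - clusters z')).

Lemma reach_refl z : reach z z.
Proof. by move=> N; rewrite big1 ?subrr ?mulr0// => i _; rewrite subrr normr0. Qed.

Lemma reach_trans z1 z2 z3 : reach z1 z2 -> reach z2 z3 -> reach z1 z3.
Proof.
move=> r12 r23; apply: l1le_le (l1le_triangle r12 r23) _.
by rewrite -mulrDr addrA subrK.
Qed.

Lemma reach_le z z' : reach z z' -> clusters z' <= clusters z.
Proof.
move/l1le_ge0; rewrite pmulr_rge0 ?subr_ge0//.
by rewrite mulr_gt0// invr_gt0 ltr0n.
Qed.

Lemma size_ind_l1le i : l1le (size_ind R ^~ i) 1.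
Proof.
move=> N; apply: le_trans (_ : \sum_(l < maxn N i.+1) `|size_ind R l i| <= _).
  by apply: (ler_sum_ord_widen (F := fun l => `|size_ind R l i|)) => //; exact: leq_maxl.
have iN : (i < maxn N i.+1)%N by rewrite leq_max leqnn orbT.
rewrite (bigD1 (Ordinal iN))//= big1 ?addr0.
  by rewrite /size_ind normr_nat lern1 leq_b1.
move=> l /eqP li; rewrite /size_ind; case: eqP => [il|_]; rewrite ?andbF ?normr0//.
by case: li; apply/val_inj.
Qed.

Lemma coalesce_reach z x y : y != x -> K (z x) (z y) != 0 ->
  reach z (coalesce z x y).
Proof.
move=> yx Kxy.
have zx0 : z x != 0%N by apply: contraNneq Kxy => ->; rewrite K_0.
have zy0 : z y != 0%N by apply: contraNneq Kxy => ->; rewrite K_sym K_0.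
have E : clusters z - clusters (coalesce z x y) = 1.
  rewrite /clusters (@sum_coalesce R n (fun i => (i != 0%N)%:R))//.
  by rewrite addn_eq0 negb_and zx0 zy0 /=; ring.
rewrite /reach E mulr1.
have := l1leM n%:R^-1 (l1leB (l1leB (size_ind_l1le (z x + z y)) (size_ind_l1le (z x))) (size_ind_l1le (z y))).
move=> /l1leN H; apply: l1le_le (eq_l1le _ H) _ => [l /=|].
  by rewrite empirical_coalesce//; ring.
rewrite ger0_norm// le_eqVlt; apply/orP; left; apply/eqP; ring.
Qed.

Lemma transition_reach t z z' : ~ reach z z' ->
  transition (@ml_generator R K n) t z z' = 0.
Proof.
apply: transition_eq0; first exact: reach_refl.
by move=> w x y w' yx Kxy; apply: reach_trans; exact: coalesce_reach.
Qed.

Lemma clusters_diff z z' :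
  n%:R^-1 * (clusters z - clusters z') <= l1dist (empirical R z) (empirical R z').
Proof.
pose N := (mass z + mass z').+1.
have E w : (mass w < N)%N ->
    n%:R^-1 * clusters w = \sum_(l < N) (l != 0%N :> nat)%:R * empirical_fun R w l.
  move=> wN; rewrite (@empirical_sum R n (fun l => (l != 0%N)%:R))// => x.
  exact: leq_ltn_trans (le_mass w x) wN.
rewrite mulrBr !E; [|by rewrite ltnS leq_addl|by rewrite ltnS leq_addr].
apply: le_trans (l1le_l1dist (empirical R z) (empirical R z') N).
rewrite -sumrB; apply: ler_sum => l _; rewrite -mulrBr.
apply: le_trans (ler_norm _) _; rewrite normrM normr_nat ler_piMl//.
by rewrite lern1 leq_b1.
Qed.

End coalescence.

(** * Uniformity in time *)

Section paths.
Variables (R : realType) (K : nat -> nat -> R) (C : R).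
Hypothesis K_ge0 : forall i j, 0 <= K i j.
Hypothesis K_sym : forall i j, K i j = K j i.
Hypothesis K_le : forall i j, K i j <= C.
Hypothesis K_0 : forall l, K 0%N l = 0.
Let C0 : 0 <= C := kernel_bound_ge0 K_ge0 K_le.
Variable n : nat.
Hypothesis n_gt0 : (0 < n)%N.
Variables (d : measure_display) (Omega : measurableType d)
  (P : probability Omega R) (X : R -> Omega -> config n).
Hypothesis X_chain : markov_chain (@ml_generator R K n) (monodisperse n) P X.
Implicit Types (z : config n) (s t h T : R).

Local Notation u := (solution K_ge0 K_sym K_le K_0).

Lemma discrete_near (I : Type) (F : set_system I) (FF : Filter F) (f : I -> config n) z :
  (f : I -> discrete_topology (config n)) x @[x --> F] -->
    (z : discrete_topology (config n)) -> \forall x \near F, f x = z.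
Proof. by move=> /(_ [set z]); apply; exact: discrete_set1. Qed.

Lemma empirical_cadlag w T : cadlag T (fun t => empirical R (X t w)).
Proof.
have [Hr Hl] := mc_cadlag X_chain w T; split=> t tT.
  apply: cvg_near_cst; have /discrete_near := Hr t tT.
  by apply: filterS => s ->.
have [l Hlt] := Hl t tT; exists (empirical R (l : config n)).
apply: cvg_near_cst; move: Hlt => /discrete_near.
by apply: filterS => s ->.
Qed.

Lemma right_cst w t : 0 <= t -> exists2 e, 0 < e & forall s, t < s < t + e -> X s w = X t w.
Proof.
move=> t0; have [Hr _] := mc_cadlag X_chain w (t + 1).
have /Hr/discrete_near : 0 <= t < t + 1 by rewrite t0 ltrDl ltr01.
rewrite near_withinE => -[e /= e0 H]; exists e => // s /andP[ts se].
apply: H => //=; rewrite distrC ger0_norm ?subr_ge0 ?ltW//.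
by rewrite ltrBlDl.
Qed.

(** Right-continuity reduces the statement to rational times, so that only
   countably many null events have to be excluded. *)
Lemma paths_reach : P.-negligible
  [set w | exists s t, [/\ 0 <= s, s <= t & ~ reach R (X s w) (X t w)]].
Proof.
pose F (k : nat) : set Omega :=
  if unpickle k is Some (q1, q2, z, z') then
    if `[< [/\ 0 <= ratr q1 :> R, (ratr q1 <= ratr q2 :> R) & ~ reach R z z'] >] then
      [set w | X (ratr q1) w = z] `&` [set w | X (ratr q2) w = z']
    else set0
  else set0.
apply: (@negligibleS _ _ _ _ (\bigcup_k F k)); last first.
  apply: negligible_bigcup => k; rewrite /F.
  case: unpickle => [[[[q1 q2] z] z']|]; last exact: negligible_set0.
  case: asboolP => [[q10 q12 nr]|_]; last exact: negligible_set0.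
  have q20 : 0 <= ratr q2 :> R := le_trans q10 q12.
  have dq : 0 <= ratr q2 - ratr q1 :> R by rewrite subr_ge0.
  apply/negligibleP.
    apply: measurableI.
      exact: (measurable_event X_chain (eq^~ z)).
    exact: (measurable_event X_chain (eq^~ z')).
  have L := P_law2 X_chain z z' q10 dq.
  rewrite (_ : ratr q1 + (ratr q2 - ratr q1) = ratr q2) in L; last by ring.
  apply: etrans L _.
  by rewrite transition_reach ?mulr0.
move=> w /= [s [t [s0 st nr]]].
have sLt : s < t.
  rewrite lt_neqAle st andbT; apply/eqP => E; apply: nr; rewrite E; exact: reach_refl.
have [e1 e10 H1] := right_cst w s0.
have [e2 e20 H2] := right_cst w (le_trans s0 st).
have /rat_in_itvoo[q1] : s < Num.min (s + e1) t by rewrite lt_min sLt ltrDl e10.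
rewrite in_itv/= lt_min => /andP[sq1 /andP[q1e q1t]].
have /rat_in_itvoo[q2] : t < t + e2 by rewrite ltrDl.
rewrite in_itv/= => /andP[tq2 q2e].
exists (pickle (q1, q2, X s w, X t w)); [exact: I|rewrite /F pickleK].
case: asboolP => [_|[]].
  by split=> /=; [apply: H1|apply: H2]; apply/andP.
by split=> //; apply/ltW; [exact: le_lt_trans s0 sq1|exact: lt_trans q1t tq2].
Qed.

Lemma time_change_id T : time_change T id.
Proof. by split=> //; apply: continuous_subspaceT => x; exact: cvg_id. Qed.

Lemma skorohod_dist_le T (f g : R -> Mplus R) e : 0 <= e ->
  (forall t, t \in `[0, T] -> l1dist (f t) (g t) <= e) ->
  (skorohod_dist T f g <= e%:E)%E.
Proof.
move=> e0 H; apply: ereal_inf_lbound; exists e => //.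
exists id; first exact: time_change_id.
by move=> t tT; rewrite subrr normr0; split=> //; exact: H.
Qed.

(** Between two grid times the path moves by at most three times the decrease of
   the density of clusters over the cell, at most [2 * del + 6 * C * (T / m)];
   adding the distance at the left grid time and the displacement of the solution
   gives the constants 7 and 24. *)
Lemma uniform_of_grid w T m del : 0 < T -> (0 < m)%N ->
  (forall s t, 0 <= s -> s <= t -> reach R (X s w) (X t w)) ->
  (forall k, (k <= m)%N -> l1dist (empirical R (X (k%:R * (T / m%:R)) w))
     (u (k%:R * (T / m%:R))) < del) ->
  forall r, r \in `[0, T] ->
    l1dist (empirical R (X r w)) (u r) <= 7 * del + 24 * C * (T / m%:R).
Proof.
move=> T0 m0 Hr; set h := T / m%:R => Hg r; rewrite in_itv/= => /andP[r0 rT].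
have h0 : 0 < h by rewrite divr_gt0// ltr0n.
have mh : m%:R * h = T by rewrite /h mulrC divfK// pnatr_eq0 -lt0n.
have del0 : 0 < del by apply: le_lt_trans (Hg 0%N _) => //; exact: l1le_ge0 (l1le_l1dist _ _).
pose k := Num.truncn (r / h).
have := truncn_itv (divr_ge0 r0 (ltW h0)).
rewrite ler_pdivlMr// ltr_pdivrMr// -/k => /andP[kr rk].
have km : (k <= m)%N.
  by rewrite -(ler_nat R) -(@ler_pM2r _ h)// mh (le_trans kr).
have [kE|] := eqVneq k m.
  have rE : r = m%:R * h by apply/le_anti; rewrite {1}mh rT -kE kr.
  rewrite rE; apply: le_trans (ltW (Hg _ (leqnn _))) _.
  have : 0 <= C * h by rewrite mulr_ge0// ltW.
  lra.
move=> kE; have {kE}km' : (k < m)%N by rewrite ltn_neqAle kE.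
set s := k%:R * h in kr; set t := k.+1%:R * h in rk.
have s0 : 0 <= s by rewrite mulr_ge0// ltW.
have tsE : t - s = h by rewrite /t /s -natr1; ring.
have G1 := Hg _ km; have G2 := Hg _ km'; rewrite -/s -/t in G1 G2.
have R1 := Hr s r s0 kr; have R2 := Hr r t r0 (ltW rk).
set p := empirical R (X s w) in G1; set q := empirical R (X t w) in G2.
have U1 : l1dist (u s) (u t) <= 6 * C * h.
  apply: le_trans (solution_lip _ _ _ _ s0 (le_trans r0 (ltW rk))) _.
  by rewrite distrC tsE ger0_norm// ltW.
have U2 : l1dist (u s) (u r) <= 6 * C * h.
  apply: le_trans (solution_lip _ _ _ _ s0 r0) _.
  rewrite distrC ger0_norm ?subr_ge0// ler_wpM2l ?mulr_ge0// -tsE lerD2r ltW//.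
have D1 : l1dist p (empirical R (X r w)) <= 3 * l1dist p q.
  apply: le_trans (_ : 3 * n%:R^-1 * (clusters R (X s w) - clusters R (X r w)) <= _).
    exact/l1dist_leP.
  rewrite -mulrA ler_wpM2l//. apply: le_trans _ (clusters_diff R (X s w) (X t w)).
  by rewrite ler_wpM2l ?invr_ge0// lerD2l lerN2 (reach_le n_gt0 R2).
have T1 : l1dist p q <= l1dist p (u s) + l1dist (u s) (u t) + l1dist (u t) q.
  apply: le_trans (l1dist_triangle (u t) _ _) _; rewrite lerD2r.
  exact: l1dist_triangle.
have T2 : l1dist (empirical R (X r w)) (u r) <=
    l1dist (empirical R (X r w)) p + l1dist p (u s) + l1dist (u s) (u r).
  apply: le_trans (l1dist_triangle (u s) _ _) _; rewrite lerD2r.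
  exact: l1dist_triangle.
rewrite [l1dist (u t) q]l1dist_sym in T1.
rewrite [l1dist _ p]l1dist_sym in T2.
lra.
Qed.

Lemma skorohod_tail T m lam : 0 < T -> (0 < m)%N -> 0 < lam ->
  (mu_ext P [set w | ((15 * lam + 24 * C * (T / m%:R))%:E <=
      skorohod_dist T (fun t => empirical R (X t w)) u)%E] <=
   (m.+1%:R * ((lam ^+ 2)^-1 * (expR (18 * C * T) * (1 + 10 * C * T))) *
      n%:R^-1)%:E)%E.
Proof.
move=> T0 m0 lam0; set e := 15 * lam + _.
have [B [mB B0 HB]] := paths_reach.
pose h := T / m%:R; have h0 : 0 < h by rewrite divr_gt0// ltr0n.
pose A (k : nat) := [set w | (2 * lam <= l1dist (empirical R (X (k%:R * h) w)) (u (k%:R * h)))%R].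
have kh0 k : 0 <= k%:R * h by rewrite mulr_ge0// ltW.
have mA k : measurable (A k).
  exact: (measurable_event X_chain (fun z => 2 * lam <= l1dist (empirical R z) (u (k%:R * h)))).
have mU : measurable (\big[setU/set0]_(k < m.+1) A k) by apply: bigsetU_measurable => k _.
have sub : [set w | (e%:E <= skorohod_dist T (fun t => empirical R (X t w)) u)%E] `<=`
    \big[setU/set0]_(k < m.+1) A k `|` B.
  move=> w /= ew; apply: contrapT => nw.
  have Hr s t : 0 <= s -> s <= t -> reach R (X s w) (X t w).
    move=> s0 st; apply: contrapT => nr; apply: nw; right; apply: HB.
    by exists s, t.
  have Hg k : (k <= m)%N -> l1dist (empirical R (X (k%:R * h) w)) (u (k%:R * h)) < 2 * lam.
    move=> km; rewrite ltNge; apply/negP => Ak; apply: nw; left.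
    have km' : (k < m.+1)%N by [].
    by rewrite (bigD1 (Ordinal km'))//=; left.
  have H := uniform_of_grid T0 m0 Hr Hg.
  have Ch : 0 <= 24 * C * h by rewrite mulr_ge0 ?mulr_ge0// ltW.
  have : (skorohod_dist T (fun t => empirical R (X t w)) u <=
      (7 * (2 * lam) + 24 * C * h)%:E)%E.
    by apply: skorohod_dist_le H; rewrite addr_ge0// mulr_ge0// mulr_ge0// ltW.
  (* The margin between [7 * (2 * lam)] and [15 * lam] makes this strict. *)
  move=> /(le_trans ew); rewrite lee_fin /e -/h; lra.
apply: le_trans (le_mu_ext P sub) _.
rewrite measurable_mu_extE; last exact: measurableU.
rewrite measureU0//.
apply: le_trans (@Boole_inequality _ _ _ P A m.+1 (fun k _ => mA k)) _.
apply: le_trans (_ : (\sum_(k < m.+1) ((lam ^+ 2)^-1 *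
   (expR (18 * C * T) * (1 + 10 * C * T)) * n%:R^-1)%:E <= _)%E).
  apply: lee_sum => k _.
  have khT : k%:R * h <= T.
    have mh : m%:R * h = T by rewrite /h mulrC divfK// pnatr_eq0 -lt0n.
    by rewrite -[leRHS]mh ler_wpM2r ?(ltW h0)// ler_nat -ltnS.
  apply: le_trans (law_large_numbers K_ge0 K_sym K_le K_0 n_gt0 X_chain (kh0 k) lam0) _.
  rewrite lee_fin ler_wpM2r ?invr_ge0// ler_wpM2l ?invr_ge0 ?exprn_ge0 ?(ltW lam0)//.
  apply: ler_pM; first exact: expR_ge0.
  - by rewrite addr_ge0// mulr_ge0// mulr_ge0.
  - by rewrite ler_expR ler_wpM2l// mulr_ge0.
  - by rewrite lerD2l ler_wpM2l// mulr_ge0.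
by rewrite sumEFin lee_fin sumr_const card_ord -[_ *+ m.+1]mulr_natl !mulrA.
Qed.

End paths.

Theorem theorem2p2 (R : realType) (K : nat -> nat -> R)
    (K_ge0 : forall i j, 0 <= K i j)
    (K_sym : forall i j, K i j = K j i)
    (K_bounded : exists C : R, forall i j, K i j <= C)
    (K_0 : forall l, K 0%N l = 0)
    (d : nat -> measure_display)
    (Omega : forall n, measurableType (d n))
    (P : forall n, probability (Omega n) R)
    (eta : forall n, R -> Omega n -> config n)
    (eta_chain : forall n, (1 <= n)%N ->
      markov_chain (@ml_generator R K n) (monodisperse n) (P n) (eta n))
    (T : R) (T_gt0 : 0 < T) :
  exists u : R -> Mplus R,
    [/\ weak_solution K T (delta1 R) u,
        (forall v : R -> Mplus R, weak_solution K T (delta1 R) v ->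
           forall t : R, t \in `[0, T] -> v t = u t),
        (forall n, (1 <= n)%N -> forall w : Omega n,
           cadlag T (fun t => empirical R (eta n t w))) &
        skorohod_cvg_in_probability T P
          (fun n t w => empirical R (eta n t w)) u].
Proof.
have [C K_le] := K_bounded; have C0 := kernel_bound_ge0 K_ge0 K_le.
exists (solution K_ge0 K_sym K_le K_0); split.
- exact: solution_weak.
- by move=> v vw t tT; exact: weak_unique vw tT.
- by move=> n n0 w; exact: empirical_cadlag (eta_chain n n0) w T.
move=> e e0.
have e2 : 0 < e / 2 by rewrite divr_gt0.
have [m Hm] : exists m : nat, 24 * C * (T / m.+1%:R) < e / 2.
  have [m _ H] := near_harmonic_lt (24 * C * T) e2.
  by exists m; rewrite mulrA; exact: (H m (leqnn m)).
(* [15 * lam] is half of [e]; the grid accounts for the other half. *)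
pose lam := e / 30; have lam0 : 0 < lam by rewrite divr_gt0.
pose c := m.+2%:R * ((lam ^+ 2)^-1 * (expR (18 * C * T) * (1 + 10 * C * T))).
have cv : (fun n : nat => (c * n%:R^-1)%:E) @ \oo --> (0%:E : \bar R).
  apply: cvg_EFin; first exact: nearW.
  rewrite -cvg_shiftS.
  have H : (fun n => c * harmonic n) @ \oo --> (0 : R).
    by rewrite -(mulr0 c); apply: cvgMl_tmp; exact: cvg_harmonic.
  exact: H.
apply: squeeze_cvge (cvg_cst 0%E) cv.
near=> n; have n0 : (0 < n)%N by near: n; exact: nbhs_infty_gt.
apply/andP; split; first exact: mu_ext_ge0.
apply: le_trans (skorohod_tail K_ge0 K_sym K_le K_0 n0 (eta_chain n n0) T_gt0 (ltn0Sn m) lam0).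
apply: le_mu_ext => w /=; apply: le_trans; rewrite lee_fin /lam.
by move: Hm; set x := 24 * C * _ => Hx; lra.
Unshelve. all: by end_near. Qed.
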